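(* For all integers $n\geq 0$ and $m\geq 0$, $$B_{3,7}\left(4^{7m}n+\frac{4^{7m}-1}{3}\right)\equiv 3^m B_{3,7}(n)\pmod 7,$$ $$B_{3,7}\left(4^{7m+7}n+\frac{10\cdot 4^{7m+6}-1}{3}\right)\equiv 0\pmod 7.$$
   Context: For integers $l,m>1$, an $l$-regular partition is a partition none of whose parts is divisible by $l$. A $(l,m)$-regular bipartition of $n$ is a pair of partitions $(\lambda,\mu)$ such that the sum of all parts of $\lambda$ and $\mu$ is $n$, $\lambda$ is $l$-regular and $\mu$ is $m$-regular. $B_{l,m}(n)$ denotes the number of $(l,m)$-regular bipartitions of $n$; equivalently $\sum_{n\ge 0}B_{l,m}(n)q^n=\frac{f_lf_m}{f_1^2}$, where $f_k=\prod_{j\ge1}(1-q^{jk})$. *)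

(* Defs.v *)
From mathcomp Require Import all_boot.

Set Implicit Arguments.
Unset Strict Implicit.
Unset Printing Implicit Defensive.

(* A partition is the weakly decreasing sequence of its (positive) parts. *)
Definition is_partition (s : seq nat) : bool := sorted geq s && all (leq 1) s.

Definition is_regular (l : nat) (s : seq nat) : bool :=
  is_partition s && all (fun i => ~~ (l %| i)) s.

Definition is_regular_bipartition (l m n : nat) (b : seq nat * seq nat) : bool :=
  [&& is_regular l b.1, is_regular m b.2 & sumn b.1 + sumn b.2 == n].

(* Since parts are positive, a partition of a number at most n has at most n
   parts, each at most n, so it lives in the finite type {bseq n of 'I_n.+1}. *)
Definition parts n (s : {bseq n of 'I_n.+1}) : seq nat := map val s.

Definition B (l m n : nat) : nat :=
  #|[set b : {bseq n of 'I_n.+1} * {bseq n of 'I_n.+1}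
       | is_regular_bipartition l m n (parts b.1, parts b.2)]|.

Lemma parts_inj n : injective (@parts n).
Proof. by move=> s t /(inj_map val_inj) /val_inj. Qed.

Lemma partsP n s : is_partition s -> sumn s <= n ->
  exists t : {bseq n of 'I_n.+1}, parts t = s.
Proof.
case/andP=> _ s_gt0 le_sn.
have le_size : size s <= n.
  apply: leq_trans le_sn; elim: s s_gt0 => //= x s IHs /andP[x_gt0 /IHs].
  by rewrite -add1n; apply: leq_add.
have s_le x : x \in s -> x < n.+1.
  move=> /perm_to_rem/perm_sumn sumE; rewrite ltnS; apply: leq_trans le_sn.
  by rewrite sumE /= leq_addr.
have size_t : size (map (@inord n) s) <= n by rewrite size_map.
exists (Bseq size_t); rewrite /parts /= -map_comp map_id_in // => x /s_le.
exact: inordK.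
Qed.

Lemma B_size l m n (r : seq (seq nat * seq nat)) :
  uniq r -> (forall b, (b \in r) = is_regular_bipartition l m n b) ->
  size r = B l m n.
Proof.
move=> r_uniq rE; rewrite /B cardE.
set A := [set b | _]; pose f (b : {bseq n of 'I_n.+1} * {bseq n of 'I_n.+1}) :=
  (parts b.1, parts b.2).
have f_inj : injective f.
  by case=> [a b] [c d] [/parts_inj-> /parts_inj->].
rewrite -(size_map f); apply/perm_size/uniq_perm => //.
  by rewrite map_inj_uniq // enum_uniq.
move=> [x y]; rewrite rE; apply/idP/mapP => [xyP|[b]]; last first.
  by rewrite mem_enum inE => bP ->.
have /and3P[/andP[/= xP _] /andP[/= yP _] /= /eqP sumE] := xyP.
have [a aE] : exists a : {bseq n of 'I_n.+1}, parts a = x.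
  by apply: partsP => //; rewrite -sumE leq_addr.
have [b bE] : exists b : {bseq n of 'I_n.+1}, parts b = y.
  by apply: partsP => //; rewrite -sumE leq_addl.
by exists (a, b); rewrite ?mem_enum ?inE /f /= aE bE.
Qed.

(* Main.v *)
(* Modulo 7 the generating function [f_3 f_7 / f_1^2] is [F = f_1^5 f_3].
   Put [G = f_1 f_3^5].  The two dissections
     odd part of F = 4 F(q^2) - 9 G,    even part of G = F + 4 q G(q^2)
   (the action of the Hecke operator [T_2] on a two-dimensional space) give, for
   the coefficients [u] of [F], [u(16n+5) = - u(4n+1) - 16 u(n)] and
   [u(16n+13) = - u(4n+3)].  Modulo 7 the characteristic polynomial
   [t^2 + t + 16] is [(t - 3)^2], so seven steps multiply by [3^7 = 3], and six
   steps from [4n+3] give 0.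

   With [phi = sum q^(k^2)], [psi = sum q^(k(k+1)/2)] and Gauss's products
   [phi(-q) = f_1^2 / f_2], [psi = f_2^2 / f_1], the dissections reduce to
   theta identities of degree 3.  Each of these is proved by showing that its
   defect [d] satisfies an equation [d * u = d(q^2) * x] with [u] invertible,
   which forces [d = 0] because [q -> q^2] doubles the order. *)
From HB Require Import structures.
From mathcomp Require Import all_boot all_algebra.
From mathcomp Require Import boolp.
From mathcomp Require Import ring.
Require Import Defs.

Set Implicit Arguments.
Unset Strict Implicit.
Unset Printing Implicit Defensive.

Import GRing.Theory.
Local Open Scope ring_scope.

(** * Formal power series *)

Record fps (R : Type) := Fps { coef : nat -> R }.

HB.instance Definition _ (R : Type) := gen_eqMixin (fps R).
HB.instance Definition _ (R : Type) := gen_choiceMixin (fps R).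

Lemma fpsP (R : Type) (u v : fps R) : (forall n, coef u n = coef v n) -> u = v.
Proof. by case: u v => [u] [v] /= uv; congr Fps; apply: funext. Qed.

Section FpsRing.

Variable R : comNzRingType.
Implicit Types u v w : fps R.

Definition trunc n u : {poly R} := \poly_(i < n.+1) coef u i.

Lemma coef_trunc n u i : (i <= n)%N -> (trunc n u)`_i = coef u i.
Proof. by rewrite coef_poly ltnS => ->. Qed.

Lemma eq_coefM n (p p' r r' : {poly R}) :
    (forall i, (i <= n)%N -> p`_i = p'`_i) -> (forall i, (i <= n)%N -> r`_i = r'`_i) ->
  (p * r)`_n = (p' * r')`_n.
Proof.
move=> pE rE; rewrite !coefM; apply: eq_bigr => i _.
by rewrite pE ?rE ?leq_subr // -ltnS.
Qed.

Definition fps0 : fps R := Fps (fun=> 0).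
Definition fps1 : fps R := Fps (fun i => (i == 0)%:R).
Definition fps_opp u := Fps (fun i => - coef u i).
Definition fps_add u v := Fps (fun i => coef u i + coef v i).
(** A coefficient of a product depends only on coefficients of index at most its own, so it is read
    off a product of truncations and the ring laws descend from [{poly R}]. *)
Definition fps_mul u v := Fps (fun i => (trunc i u * trunc i v)`_i).

Lemma fps_addA : associative fps_add.
Proof. by move=> u v w; apply: fpsP => n /=; rewrite addrA. Qed.
Lemma fps_addC : commutative fps_add.
Proof. by move=> u v; apply: fpsP => n /=; rewrite addrC. Qed.
Lemma fps_add0 : left_id fps0 fps_add.
Proof. by move=> u; apply: fpsP => n /=; rewrite add0r. Qed.
Lemma fps_addN : left_inverse fps0 fps_opp fps_add.
Proof. by move=> u; apply: fpsP => n /=; rewrite addNr. Qed.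

HB.instance Definition _ :=
  GRing.isZmodule.Build (fps R) fps_addA fps_addC fps_add0 fps_addN.

Lemma coef_mul_trunc n k u v :
  (k <= n)%N -> coef (fps_mul u v) k = (trunc n u * trunc n v)`_k.
Proof.
by move=> kn; apply: eq_coefM => i ik; rewrite !coef_trunc // (leq_trans ik).
Qed.

Lemma fps_mulA : associative fps_mul.
Proof.
move=> u v w; apply: fpsP => n /=.
transitivity ((trunc n u * (trunc n v * trunc n w))`_n).
  by apply: eq_coefM => // i le_in; rewrite coef_trunc // (coef_mul_trunc _ _ le_in).
rewrite mulrA; apply: eq_coefM => // i le_in.
by rewrite coef_trunc // (coef_mul_trunc _ _ le_in).
Qed.

Lemma fps_mulC : commutative fps_mul.
Proof. by move=> u v; apply: fpsP => n /=; rewrite mulrC. Qed.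

Lemma fps_mul1 : left_id fps1 fps_mul.
Proof.
move=> u; apply: fpsP => n /=; rewrite -(coef_trunc _ (leqnn n)).
rewrite -[in RHS](mul1r (trunc n u)); apply: eq_coefM => // i le_in.
by rewrite coef_trunc // coef1.
Qed.

Lemma fps_mulDl : left_distributive fps_mul fps_add.
Proof.
move=> u v w; apply: fpsP => n /=; rewrite -coefD -mulrDl.
by apply: eq_coefM => // i le_in; rewrite coefD !coef_trunc.
Qed.

Lemma fps1_neq0 : fps1 != 0.
Proof.
by apply/eqP => /(congr1 (fun u : fps R => coef u 0))/eqP; rewrite /= oner_eq0.
Qed.

HB.instance Definition _ := GRing.Zmodule_isComNzRing.Build (fps R)
  fps_mulA fps_mulC fps_mul1 fps_mulDl fps1_neq0.

Lemma coef1 n : coef (1 : fps R) n = (n == 0)%:R. Proof. by []. Qed.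
Lemma coefN u n : coef (- u) n = - coef u n. Proof. by []. Qed.
Lemma coefD u v n : coef (u + v) n = coef u n + coef v n. Proof. by []. Qed.
Lemma coefMt n k u v :
  (k <= n)%N -> coef (u * v) k = (trunc n u * trunc n v)`_k.
Proof. exact: coef_mul_trunc. Qed.

Lemma coefM u v n : coef (u * v) n = \sum_(i < n.+1) coef u i * coef v (n - i).
Proof.
rewrite (coefMt _ _ (leqnn n)) poly.coefM; apply: eq_bigr => i _.
by rewrite !coef_trunc ?leq_subr // -ltnS.
Qed.

Lemma coefM0 u v : coef (u * v) 0 = coef u 0 * coef v 0.
Proof. by rewrite coefM big_ord_recl big_ord0 addr0. Qed.

Definition fpsX : fps R := Fps (fun i => (i == 1)%:R).

Lemma coefXM u n : coef (fpsX * u) n = if n is k.+1 then coef u k else 0.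
Proof.
rewrite coefM; case: n => [|n]; first by rewrite big_ord_recl big_ord0 mul0r addr0.
rewrite big_ord_recl mul0r add0r big_ord_recl /= mul1r subn1 big1 ?addr0 //.
by move=> i _; rewrite mul0r.
Qed.

Lemma coefXnM k u n : coef (fpsX ^+ k * u) n = if (n < k)%N then 0 else coef u (n - k).
Proof.
elim: k n => [|k IHk] n; first by rewrite mul1r subn0.
by rewrite exprS -mulrA coefXM; case: n => // n; rewrite IHk.
Qed.

Lemma fpsX_inj : injective ( *%R fpsX).
Proof.
by move=> u v uv; apply: fpsP => n; rewrite -[LHS](coefXM _ n.+1) uv coefXM.
Qed.

(** Congruence modulo [q^(n+1)]: identities between infinite sums and products are proved at every
    order through finite truncations. *)
Definition eqfps n u v := forall i, (i <= n)%N -> coef u i = coef v i.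

Lemma eqfps_refl n u : eqfps n u u. Proof. by []. Qed.
Lemma eqfps_sym n u v : eqfps n u v -> eqfps n v u.
Proof. by move=> uv i /uv. Qed.
Lemma eqfps_trans n v u w : eqfps n u v -> eqfps n v w -> eqfps n u w.
Proof. by move=> uv vw i le_in; rewrite uv ?vw. Qed.
Lemma eqfpsW m n u v : (m <= n)%N -> eqfps n u v -> eqfps m u v.
Proof. by move=> mn uv i im; apply/uv/(leq_trans im). Qed.
Lemma eqfpsD n u u' v v' :
  eqfps n u u' -> eqfps n v v' -> eqfps n (u + v) (u' + v').
Proof. by move=> uu' vv' i le_in; rewrite !coefD uu' ?vv'. Qed.
Lemma eqfpsM n u u' v v' :
  eqfps n u u' -> eqfps n v v' -> eqfps n (u * v) (u' * v').
Proof.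
move=> uu' vv' i le_in; rewrite !(coefMt _ _ (leqnn i)); apply: eq_coefM => j ji.
  by rewrite !coef_trunc ?uu' // (leq_trans ji).
by rewrite !coef_trunc ?vv' // (leq_trans ji).
Qed.
Lemma eqfpsX n k u v : eqfps n u v -> eqfps n (u ^+ k) (v ^+ k).
Proof. by move=> uv; elim: k => // k IHk; rewrite !exprS; apply: eqfpsM. Qed.
Lemma eqfpsP u v : (forall n, eqfps n u v) -> u = v.
Proof. by move=> uv; apply: fpsP => n; apply: uv. Qed.
Lemma eqfps_Xn n u v w k : (n < k)%N -> eqfps n u v -> eqfps n (u + fpsX ^+ k * w) v.
Proof.
move=> nk uv i le_in.
by rewrite coefD coefXnM (leq_ltn_trans le_in nk) addr0 uv.
Qed.

(** The diagonal limit; it is meaningful when passing from [s k] to [s k.+1] leaves the coefficients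
    up to [k] unchanged. *)
Definition fps_lim (s : nat -> fps R) := Fps (fun n => coef (s n) n).

Lemma fps_limP (s : nat -> fps R) n :
  (forall k, eqfps k (s k.+1) (s k)) -> eqfps n (fps_lim s) (s n).
Proof.
move=> sP i le_in /=; rewrite -(subnK le_in); elim: (n - i)%N => // k IHk.
by rewrite IHk addSn sP ?leq_addl.
Qed.

(** The substitution [q -> q^k]. *)
Definition dil k u := Fps (fun n => if (k %| n)%N then coef u (n %/ k)%N else 0).

Lemma coef_dil k u n :
  coef (dil k u) n = if (k %| n)%N then coef u (n %/ k)%N else 0.
Proof. by []. Qed.

Lemma eqfps_dil n k u v : eqfps n u v -> eqfps n (dil k u) (dil k v).
Proof.
move=> uv i le_in /=; case: ifP => // _.
by rewrite uv // (leq_trans (leq_div _ _)).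
Qed.

Lemma trunc_dil n k u i : (0 < k)%N -> (i <= n)%N ->
  (trunc n (dil k u))`_i = (trunc n u \Po 'X^k)`_i.
Proof.
move=> k_gt0 le_in; rewrite coef_comp_poly_Xn // coef_trunc //=.
by case: ifP => // _; rewrite coef_trunc // (leq_trans (leq_div _ _)).
Qed.

Fact dil_is_zmod_morphism k : zmod_morphism (dil k).
Proof. by move=> u v; apply: fpsP => n /=; case: ifP; rewrite ?subrr. Qed.
HB.instance Definition _ k :=
  GRing.isZmodMorphism.Build (fps R) (fps R) (dil k) (dil_is_zmod_morphism k).

(** On truncations the substitution is composition with the polynomial ['X^(k.+1)], which is
    multiplicative; the successor supplies a positive exponent. *)
Fact dilS_is_monoid_morphism k : monoid_morphism (dil k.+1).
Proof.
split=> [|u v]; apply: fpsP => n.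
  case: n => [|n] /=; first by [].
  by case: ifP => // dvd_kn; rewrite eqn0Ngt divn_gt0 // dvdn_leq.
transitivity (((trunc n u * trunc n v) \Po 'X^(k.+1))`_n).
  rewrite coef_comp_poly_Xn // coef_dil; case: ifP => // _.
  by rewrite (@coefMt n) // leq_div.
rewrite rmorphM (coefMt _ _ (leqnn n)); by apply: eq_coefM => i le_in; rewrite trunc_dil.
Qed.
HB.instance Definition _ k :=
  GRing.isMonoidMorphism.Build (fps R) (fps R) (dil k.+1)
    (dilS_is_monoid_morphism k).

Lemma dil1 k : dil k.+1 1 = 1. Proof. exact: rmorph1. Qed.
Lemma dilN k u : dil k (- u) = - dil k u. Proof. exact: raddfN. Qed.
Lemma dilD k u v : dil k (u + v) = dil k u + dil k v. Proof. exact: raddfD. Qed.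
Lemma dilM k u v : dil k.+1 (u * v) = dil k.+1 u * dil k.+1 v.
Proof. exact: rmorphM. Qed.
Lemma dilXn k u n : dil k.+1 (u ^+ n) = dil k.+1 u ^+ n.
Proof. exact: rmorphXn. Qed.
Lemma dil_nat k n : dil k.+1 n%:R = n%:R. Proof. exact: rmorph_nat. Qed.

Lemma dil_fpsX k : dil k.+1 fpsX = fpsX ^+ k.+1.
Proof.
apply: fpsP => n; rewrite coef_dil -[in RHS](mulr1 (_ ^+ _)) coefXnM coef1.
case: ifP => [/dvdnP[m ->]|k_n]; last first.
  case: ltnP => // le_kn; case: eqP => // n_k; rewrite -(subnK le_kn) n_k in k_n.
  by rewrite dvdnn in k_n.
have -> : (m * k.+1 - k.+1 = (m - 1) * k.+1)%N by rewrite mulnBl mul1n.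
rewrite mulnK // muln_eq0 orbF.
by case: m => [|[|m]] //=; rewrite mulSn ltnNge leq_addr.
Qed.

Lemma dil_dil j k u : dil j.+1 (dil k.+1 u) = dil (j.+1 * k.+1)%N u.
Proof.
apply: fpsP => n /=; case: ifP => [/dvdnP[m ->]|jn].
  by rewrite mulnK // [(m * _)%N]mulnC dvdn_pmul2l // divnMl.
by case: ifP => // /(dvdn_trans (dvdn_mulr _ (dvdnn _))); rewrite jn.
Qed.

Lemma dil_inj k : injective (dil k.+1).
Proof.
move=> u v uv; apply: fpsP => n; have := congr1 (fun w => coef w (n * k.+1)) uv.
by rewrite !coef_dil dvdn_mull // mulnK.
Qed.

Lemma coefMn u m n : coef (u *+ m) n = coef u n *+ m.
Proof. by elim: m => // m IHm; rewrite !mulrS coefD IHm. Qed.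

Lemma fps_decomp u m : coef u 0 = m%:R -> exists v, u = m%:R + fpsX * v.
Proof.
move=> u0; exists (Fps (fun n => coef u n.+1)); apply: fpsP => n.
by rewrite coefD coefXM coefMn; case: n => [|n]; rewrite ?addr0 // mul0rn add0r.
Qed.

Definition dilE := (dil_dil, dil_fpsX, dil_nat, dil1, dilXn, dilM, dilN, dilD).

(** Write [u = m + q v]. The Frobenius map is additive and fixes the natural number [m], so the
    claim for [u] reduces to the claim for [v] at a smaller index. *)
Lemma dil_Frobenius p u : p.+1 \in [pchar R] -> (forall x : R, exists m, x = m%:R) ->
  dil p.+1 u = u ^+ p.+1.
Proof.
move=> pR natR; have pF : p.+1 \in [pchar fps R].
  have /andP[p_pr /eqP p0] := pR; apply/andP; split=> //; apply/eqP/fpsP => n.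
  by rewrite coefMn -[_ *+ p.+1]mulr_natr p0 mulr0.
apply: fpsP => n; have [k] := ubnP n; elim: k n u => // k IHk n u nk.
have [m /fps_decomp[v ->]] := natR (coef u 0).
rewrite dilD dilM dil_nat dil_fpsX.
rewrite -[RHS](congr1 (fun w => coef w n) (pFrobenius_autE pF _)).
rewrite pFrobenius_autD_comm; last exact: mulrC.
rewrite pFrobenius_aut_nat pFrobenius_autE exprMn !coefD; congr (_ + _).
rewrite !coefXnM; case: ltnP => // pn; apply: IHk.
by rewrite -ltnS (leq_trans _ nk) // ltnS -subSn // leq_subLR addSn ltnS leq_addl.
Qed.

(** The substitution [q -> -q]. *)
Definition fps_sign u := Fps (fun n => (-1) ^+ n * coef u n).

Lemma coef_sign u n : coef (fps_sign u) n = (-1) ^+ n * coef u n.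
Proof. by []. Qed.

Fact fps_sign_is_zmod_morphism : zmod_morphism fps_sign.
Proof. by move=> u v; apply: fpsP => n; rewrite /= mulrBr. Qed.
HB.instance Definition _ := GRing.isZmodMorphism.Build (fps R) (fps R) fps_sign
  fps_sign_is_zmod_morphism.

Fact fps_sign_is_monoid_morphism : monoid_morphism fps_sign.
Proof.
split=> [|u v]; apply: fpsP => n; first by case: n => [|n] /=; rewrite ?mulr1 ?mulr0.
rewrite coef_sign !coefM mulr_sumr; apply: eq_bigr => i _.
by rewrite !coef_sign mulrACA -exprD subnKC // -ltnS.
Qed.
HB.instance Definition _ := GRing.isMonoidMorphism.Build (fps R) (fps R) fps_sign
  fps_sign_is_monoid_morphism.

Lemma fps_signK : involutive fps_sign.
Proof. by move=> u; apply: fpsP => n; rewrite /= signrMK. Qed.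

Lemma fps_sign1 : fps_sign 1 = 1. Proof. exact: rmorph1. Qed.
Lemma fps_signN u : fps_sign (- u) = - fps_sign u. Proof. exact: raddfN. Qed.
Lemma fps_signD u v : fps_sign (u + v) = fps_sign u + fps_sign v.
Proof. exact: raddfD. Qed.
Lemma fps_signM u v : fps_sign (u * v) = fps_sign u * fps_sign v.
Proof. exact: rmorphM. Qed.
Lemma fps_signXn u n : fps_sign (u ^+ n) = fps_sign u ^+ n.
Proof. exact: rmorphXn. Qed.
Lemma fps_sign_nat n : fps_sign n%:R = n%:R. Proof. exact: rmorph_nat. Qed.

Lemma fps_sign_X : fps_sign fpsX = - fpsX.
Proof.
by apply: fpsP => -[|[|n]]; rewrite /= ?mulr0 ?mulr1 ?oppr0.
Qed.

Lemma fps_sign_dil_even k u : ~~ odd k -> fps_sign (dil k u) = dil k u.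
Proof.
move=> k_even; apply: fpsP => n /=; case: ifP => [/dvdnP[m ->]|]; last by rewrite mulr0.
by rewrite -signr_odd oddM (negbTE k_even) andbF mul1r.
Qed.

Lemma fps_sign_dil_odd k u : odd k -> fps_sign (dil k u) = dil k (fps_sign u).
Proof.
move=> k_odd; have k0 : (0 < k)%N by case: k k_odd.
apply: fpsP => n /=; case: ifP => [/dvdnP[m ->]|]; last by rewrite mulr0.
by rewrite mulnK // -signr_odd oddM k_odd andbT signr_odd.
Qed.

Definition fps_signE := (fps_signK, fps_sign_X, fps_sign_nat, fps_sign1,
  fps_signXn, fps_signM, fps_signN, fps_signD).

End FpsRing.

(** * Cancellation and rigidity of series over an integral domain *)

Section FpsDomain.

Variable R : idomainType.
Implicit Types u v w d : fps R.

Lemma fps_mulI u v w : coef u 0 != 0 -> u * v = u * w -> v = w.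
Proof.
move=> u0 /eqP; rewrite -subr_eq0 -mulrBr => /eqP uvw.
apply/eqP; rewrite -subr_eq0; apply/eqP; move: (v - w) uvw => {v w} d ud.
apply: fpsP => n; have [k] := ubnP n; elim: k n => // k IHk n; rewrite ltnS => nk.
have := congr1 (fun x => coef x n) ud; rewrite coefM big_ord_recl subn0 big1.
  by rewrite addr0 => /eqP; rewrite mulf_eq0 (negbTE u0) => /eqP.
move=> i _; rewrite IHk ?mulr0 // (leq_trans _ nk) // ltn_subrL //.
by rewrite (leq_trans _ (ltn_ord i)).
Qed.

(* If [k > 0] were the least order of [d] and [e], the right-hand sides would
   have order at least [2 k], since substituting [q ^ 2] for [q] doubles orders,
   while one of the left-hand sides has order [k]. *)
Lemma dil2_rigid2 d e u v x y z t : coef d 0 = 0 -> coef e 0 = 0 ->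
    coef u 0 != 0 -> coef v 0 != 0 ->
    u * d = dil 2 d * x + dil 2 e * y -> v * e = dil 2 d * z + dil 2 e * t ->
  d = 0 /\ e = 0.
Proof.
move=> d0 e0 u0 v0 du ev.
suff /all_and2[dn en] : forall n, coef d n = 0 /\ coef e n = 0 by split; apply: fpsP.
move=> n; have [k] := ubnP n; elim: k n => // k IHk n; rewrite ltnS => nk.
have low (w : fps R) : (forall i, (i < n)%N -> coef w i = 0) -> coef w 0 = 0 ->
    forall i, (i <= n)%N -> coef (dil 2 w) i = 0.
  move=> wn w0 i le_in; rewrite coef_dil; case: ifP => // _.
  by case: i le_in => // i le_in; rewrite wn // (leq_trans _ le_in) // ltn_Pdiv.
have lowM (a b : fps R) : (forall i, (i <= n)%N -> coef a i = 0) -> coef (a * b) n = 0.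
  by move=> a0; rewrite coefM big1 // => i _; rewrite a0 ?mul0r // -ltnS.
have top (a b : fps R) : (forall i, (i < n)%N -> coef b i = 0) ->
    coef a 0 != 0 -> coef (a * b) n = 0 -> coef b n = 0.
  move=> b_lt a0; rewrite coefM big_ord_recl subn0 big1.
    by rewrite addr0 => /eqP; rewrite mulf_eq0 (negbTE a0) => /eqP.
  move=> i _; rewrite b_lt ?mulr0 // ltn_subrL //.
  by rewrite (leq_trans _ (ltn_ord i)).
have dn i : (i < n)%N -> coef d i = 0 by move=> lt_in; case: (IHk i (leq_trans lt_in nk)).
have en i : (i < n)%N -> coef e i = 0 by move=> lt_in; case: (IHk i (leq_trans lt_in nk)).
split; [apply: (top u) => //; rewrite du | apply: (top v) => //; rewrite ev];
  by rewrite coefD !lowM ?addr0 //; apply: low.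
Qed.

Lemma dil2_rigid d u x : coef d 0 = 0 -> coef u 0 != 0 -> u * d = dil 2 d * x -> d = 0.
Proof.
move=> d0 u0 du; case: (@dil2_rigid2 d 0 u 1 x 0 0 0) => //.
- by rewrite coef1 oner_eq0.
- by rewrite mulr0 addr0.
by rewrite !mulr0 addr0.
Qed.

End FpsDomain.

(** * Euler's product and Gauss's theta functions *)

Lemma sum1S (V : nmodType) (g : nat -> V) n :
  \sum_(1 <= s < n.+2) g s = \sum_(1 <= s < n.+1) g s + g n.+1.
Proof. by rewrite big_nat_recr. Qed.

Lemma prod1S (S : pzSemiRingType) (g : nat -> S) n :
  \prod_(1 <= s < n.+2) g s = \prod_(1 <= s < n.+1) g s * g n.+1.
Proof. by rewrite big_nat_recr. Qed.

Section Shanks.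

Variables (S : comNzRingType) (x : S).

Let N s n := \prod_(s.+1 <= k < n.+1) (1 - x ^+ k).
Let M s := \prod_(1 <= k < s) (1 + x ^+ k).
Let t n s := (-1) ^+ s * 2 * x ^+ (s * n.+1) * N s n * M s.

(** Passing from [n] to [n.+1] multiplies the left-hand side of [shanks] by [1 + x ^+ n.+1], up to a
    telescoping boundary term. The cut-off [j] is left free for the induction. *)
Lemma shanks_step n j : (j <= n)%N ->
  N 0 n * (1 - x ^+ n.+1) + \sum_(1 <= s < j.+1) t n.+1 s =
  (1 + x ^+ n.+1) * (N 0 n + \sum_(1 <= s < j.+1) t n s)
    - (-1) ^+ j * 2 * x ^+ (j.+1 * n.+1) * N j n * M j.+1.
Proof.
elim: j => [|j IHj] jn.
  by rewrite !big_geq // mul1n /M big_geq //; ring.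
rewrite 2!sum1S addrA IHj ?(ltnW jn) // /t.
have -> : N j n = (1 - x ^+ j.+1) * N j.+1 n by rewrite /N big_ltn.
have -> : N j.+1 n.+1 = N j.+1 n * (1 - x ^+ n.+1) by rewrite /N big_nat_recr.
have -> : M j.+2 = M j.+1 * (1 + x ^+ j.+1) by rewrite /M big_nat_recr.
have -> : x ^+ (j.+1 * n.+2) = x ^+ (j.+1 * n.+1) * x ^+ j.+1.
  by rewrite -exprD -mulnSr.
have -> : x ^+ (j.+2 * n.+1) = x ^+ (j.+1 * n.+1) * x ^+ n.+1.
  by rewrite -exprD -mulSnr.
by rewrite [(-1) ^+ j.+1]exprS; ring.
Qed.

(* Shanks's finite form of Gauss's product for [sum (-1)^k x^(k^2)]. *)
Lemma shanks n :
  N 0 n + \sum_(1 <= s < n.+1) t n s =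
  (1 + 2 * \sum_(1 <= k < n.+1) (-1) ^+ k * x ^+ (k ^ 2)) * M n.+1.
Proof.
elim: n => [|n IHn]; first by rewrite /N /M !big_geq //; ring.
have N0 : N 0 n.+1 = N 0 n * (1 - x ^+ n.+1) by rewrite /N big_nat_recr.
(* At [j = n] the boundary term and the new summand of index [n.+1] together give the new square
   term times [M n.+2]. *)
rewrite N0 2!sum1S addrA shanks_step // IHn /t.
have -> : N n n = 1 by rewrite /N big_geq.
have -> : N n.+1 n.+1 = 1 by rewrite /N big_geq.
have -> : M n.+2 = M n.+1 * (1 + x ^+ n.+1) by rewrite /M big_nat_recr.
have -> : x ^+ (n.+1 * n.+2) = x ^+ (n.+1 * n.+1) * x ^+ n.+1.
  by rewrite -exprD -mulnSr.
by rewrite -mulnn [(-1) ^+ n.+1]exprS; ring.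
Qed.

End Shanks.

Section Theta.

Variable R : comNzRingType.
Notation q := (fpsX R).

Definition euler_prod n : fps R := \prod_(1 <= k < n.+1) (1 - q ^+ k).
Definition phi_sum n : fps R := 1 + 2 * \sum_(1 <= k < n.+1) q ^+ (k ^ 2).
Definition psi_sum n : fps R := \sum_(0 <= k < n.+1) q ^+ 'C(k.+1, 2).

Definition euler : fps R := fps_lim euler_prod.
Definition phi : fps R := fps_lim phi_sum.
Definition psi : fps R := fps_lim psi_sum.

Lemma euler_trunc n : eqfps n euler (euler_prod n).
Proof.
apply: fps_limP => k; rewrite /euler_prod big_nat_recr //= mulrBr mulr1 mulrC -mulrN.
exact: eqfps_Xn.
Qed.

Lemma phi_trunc n : eqfps n phi (phi_sum n).
Proof.
apply: fps_limP => k; rewrite /phi_sum big_nat_recr //= mulrDr addrA.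
rewrite [2 * q ^+ _]mulrC; apply: eqfps_Xn => //.
by rewrite -mulnn mulSn ltnS leq_addr.
Qed.

Lemma psi_trunc n : eqfps n psi (psi_sum n).
Proof.
apply: fps_limP => k; rewrite /psi_sum (big_nat_recr k.+1) //= -[q ^+ _]mulr1.
by apply: eqfps_Xn => //; rewrite binS bin1 leq_addl.
Qed.

Lemma eqfps_sign n (u v : fps R) : eqfps n u v -> eqfps n (fps_sign u) (fps_sign v).
Proof. by move=> uv i /uv uvi; rewrite !coef_sign uvi. Qed.

(** In [shanks] every summand carries [q^(s(n+1))] with [s >= 1], so modulo [q^(n+1)] only the Euler
    product remains on the left. The factor [M] is then absorbed by [f_2 = f_1 * prod (1 + q^k)]. *)
Lemma phi_gauss : fps_sign phi * dil 2 euler = euler ^+ 2.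
Proof.
apply: eqfpsP => n.
pose M := \prod_(1 <= k < n.+1) (1 + q ^+ k).
have phiE : eqfps n (fps_sign phi * M) (euler_prod n).
  apply: eqfps_trans (eqfpsM (eqfps_sign (@phi_trunc n)) (eqfps_refl M)) _.
  rewrite /phi_sum fps_signD fps_sign1 fps_signM fps_sign_nat raddf_sum.
  rewrite (eq_bigr (fun k => (-1) ^+ k * q ^+ (k ^ 2))); last first.
    move=> k _ /=; rewrite fps_signXn fps_sign_X [(- q) ^+ _]exprNn -mulnn.
    by rewrite -[in LHS]signr_odd oddM andbb signr_odd.
  rewrite -shanks -[X in eqfps n X]addr0.
  apply: (@eqfps_trans _ _ (euler_prod n + 0)); last by rewrite addr0.
  rewrite addr0; apply: eqfpsD => // i le_in.
  rewrite big_seq (big_ind (fun w => coef w i = 0)) // => [u v u0 v0|s].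
    by rewrite coefD u0 v0 addr0.
  rewrite mem_index_iota => /andP[s_gt0 _]; rewrite [_ * q ^+ _]mulrC -!mulrA coefXnM.
  by rewrite (leq_ltn_trans le_in) // leq_pmull.
have eulerM : dil 2 (euler_prod n) = euler_prod n * M.
  rewrite /euler_prod -big_split /= (big_morph _ (@dilM R 1) (@dil1 R 1)).
  apply: eq_bigr => k _; rewrite !dilE -exprM mulnC exprM; ring.
apply: (@eqfps_trans _ _ (fps_sign phi * dil 2 (euler_prod n))).
  by apply: eqfpsM => //; apply/eqfps_dil/euler_trunc.
rewrite eulerM mulrCA expr2.
apply: eqfps_sym; apply: eqfpsM; first exact: euler_trunc.
exact: eqfps_trans (@euler_trunc n) (eqfps_sym phiE).
Qed.

Lemma phi_sumS n : phi_sum n.+1 = phi_sum n + 2 * q ^+ (n.+1 ^ 2).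
Proof. by rewrite /phi_sum sum1S mulrDr addrA. Qed.

Lemma psi_sumS n : psi_sum n.+1 = psi_sum n + q ^+ 'C(n.+2, 2).
Proof. by rewrite /psi_sum big_nat_recr. Qed.

(** Split the squares by parity: [(2k)^2 = 4 k^2], while [(2k+1)^2] is [1] plus eight times a
    triangular number. Stopping at the odd index [n.*2.+1] pairs the two finite sums exactly. *)
Lemma phi_dil4 : phi = dil 4 phi + 2 * q * dil 8 psi.
Proof.
apply: eqfpsP => n.
have phiE : phi_sum n.*2.+1 = dil 4 (phi_sum n) + 2 * q * dil 8 (psi_sum n).
  elim: n => [|n IHn].
    by rewrite /phi_sum /psi_sum !big_nat1 big_geq // exp1n bin_small // !dilE; ring.
  have sq0 : (n.*2.+2 ^ 2 = 4 * n.+1 ^ 2)%N by rewrite -doubleS -muln2 expnMn mulnC.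
  have sq1 : (n.*2.+3 ^ 2 = 1 + 8 * 'C(n.+2, 2))%N.
    rewrite (_ : 8 = 4 * 2)%N // -mulnA -mul_bin_diag bin1 -muln2 -mulnn /=; ring.
  rewrite doubleS 2!phi_sumS IHn sq0 sq1 phi_sumS psi_sumS exprD expr1 !dilE -!exprM.
  ring.
apply: (@eqfps_trans _ _ (phi_sum n.*2.+1)).
  by apply: (eqfpsW _ (@phi_trunc n.*2.+1)); rewrite -addnn -addnS leq_addr.
rewrite phiE; apply: eqfps_sym; apply: eqfpsD.
  exact/eqfps_dil/phi_trunc.
by apply: eqfpsM => //; apply/eqfps_dil/psi_trunc.
Qed.

(* [odd_prod(q) = prod (1 - q^(2k-1))] satisfies
   [odd_prod(q) * odd_prod(-q) = odd_prod(q^2)] and [f_1 = f_2 * odd_prod]. *)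
Lemma euler_sign :
  euler * fps_sign euler * dil 4 euler = dil 2 euler ^+ 3.
Proof.
apply: eqfpsP => n.
pose odd_prod := \prod_(1 <= k < n.+1) (1 - q ^+ k.*2.-1).
have eulerD : euler_prod n.*2 = dil 2 (euler_prod n) * odd_prod.
  rewrite /euler_prod /odd_prod (big_morph _ (@dilM R 1) (@dil1 R 1)) -big_split /=.
  elim: n {odd_prod} => [|n IHn]; first by rewrite !big_geq.
  rewrite doubleS !prod1S IHn.
  by rewrite -!mulrA; congr (_ * _); rewrite !dilE -exprM mul2n mulrC.
have sign_odd : odd_prod * fps_sign odd_prod = dil 2 odd_prod.
  rewrite /odd_prod (big_morph _ (@dilM R 1) (@dil1 R 1)).
  rewrite (big_morph _ (@fps_signM R) (@fps_sign1 R)) -big_split /=.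
  rewrite big_seq [RHS]big_seq; apply: eq_bigr => k.
  rewrite mem_index_iota => /andP[k_gt0 _].
  rewrite !dilE fps_signD fps_signN fps_sign1 fps_signXn fps_sign_X exprNn.
  have k_odd : odd k.*2.-1 by case: k k_gt0 => // k _; rewrite doubleS /= odd_double.
  rewrite -signr_odd k_odd.
  rewrite -exprM mulnC exprM; ring.
have eulerE : eqfps n euler (dil 2 (euler_prod n) * odd_prod).
  rewrite -eulerD; apply: (eqfpsW _ (@euler_trunc n.*2)).
  by rewrite -addnn leq_addr.
pose e := euler_prod n.
apply: (@eqfps_trans _ _ (dil 2 e * odd_prod * (dil 2 e * fps_sign odd_prod) * dil 4 e)).
  apply: eqfpsM; last exact/eqfps_dil/euler_trunc.
  apply: eqfpsM => //; rewrite -(@fps_sign_dil_even _ 2 e) // -fps_signM.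
  exact: eqfps_sign.
apply: (@eqfps_trans _ _ (dil 2 e ^+ 2 * dil 2 (dil 2 e * odd_prod))).
  by rewrite dilM -sign_odd dil_dil => i _; congr coef; ring.
rewrite [in X in eqfps _ _ X]exprSr; apply: eqfpsM.
  exact/eqfpsX/eqfps_dil/eqfps_sym/euler_trunc.
exact/eqfps_dil/eqfps_sym.
Qed.

Lemma coef0_euler : coef euler 0 = 1.
Proof. by rewrite /= /euler_prod big_geq. Qed.

Lemma coef0_phi : coef phi 0 = 1.
Proof. by rewrite -[LHS]/(coef (phi_sum 0) 0) /phi_sum big_geq // mulr0 addr0. Qed.

Lemma coef0_psi : coef psi 0 = 1.
Proof. by rewrite /= /psi_sum big_nat1. Qed.

End Theta.

(** * Theta identities *)

Section CoefZero.

Variable R : comNzRingType.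
Implicit Types u v : fps R.

Lemma coef0_dil k u : coef (dil k u) 0 = coef u 0.
Proof. by rewrite coef_dil dvdn0 div0n. Qed.

Lemma coef0_sign u : coef (fps_sign u) 0 = coef u 0.
Proof. by rewrite coef_sign mul1r. Qed.

Lemma coef0_exp u n : coef (u ^+ n) 0 = coef u 0 ^+ n.
Proof. by elim: n => // n IHn; rewrite !exprS coefM0 IHn. Qed.

Lemma coef0_fpsX : coef (fpsX R) 0 = 0. Proof. by []. Qed.

Lemma coef0_nat n : coef (n%:R : fps R) 0 = n%:R.
Proof. by rewrite coefMn. Qed.

Definition coef0E := (coef0_psi, coef0_phi, coef0_euler, coef0_nat, coef0_fpsX,
  coef0_exp, coef0_sign, coef0_dil, coefM0, coefN, coefD).

End CoefZero.

Section ThetaIdentities.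

Variable R : idomainType.
Hypothesis two_neq0 : 2 != 0 :> R.
Notation q := (fpsX R).
Notation phi := (phi R).
Notation psi := (psi R).
Notation euler := (euler R).

(** The factor [u + v] of [u^2 - v^2] has constant term [2], hence can be cancelled. *)
Lemma fps_sqr_inj (u v : fps R) :
  coef u 0 = 1 -> coef v 0 = 1 -> u ^+ 2 = v ^+ 2 -> u = v.
Proof.
move=> u0 v0 uv; apply: (@fps_mulI _ (u + v)); first by rewrite coefD u0 v0.
by transitivity (u ^+ 2 + u * v); [ring | rewrite uv; ring].
Qed.

Lemma phi_dil2_gauss : phi * dil 2 euler = fps_sign euler ^+ 2.
Proof.
have := congr1 (@fps_sign R) (phi_gauss R).
by rewrite fps_signM fps_signXn fps_signK fps_sign_dil_even.
Qed.

(** Multiplied by [f_2^2 f_4^2], both sides become [f_2^6], by Gauss's product, its images under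
    [q -> -q] and [q -> q^2], and [euler_sign]. *)
Lemma phi_mul_sign : phi * fps_sign phi = dil 2 (fps_sign phi) ^+ 2.
Proof.
have G2 : dil 2 (fps_sign phi) * dil 4 euler = dil 2 euler ^+ 2.
  by have := congr1 (dil 2) (phi_gauss R); rewrite !dilE.
apply: (@fps_mulI _ (dil 2 euler ^+ 2 * dil 4 euler ^+ 2)).
  by rewrite !coef0E !expr1n mulr1 oner_neq0.
transitivity ((phi * dil 2 euler) * (fps_sign phi * dil 2 euler) * dil 4 euler ^+ 2).
  by ring.
rewrite phi_dil2_gauss phi_gauss.
transitivity ((euler * fps_sign euler * dil 4 euler) ^+ 2); first by ring.
rewrite euler_sign.
transitivity (dil 2 euler ^+ 2 * (dil 2 (fps_sign phi) * dil 4 euler) ^+ 2).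
  by rewrite G2; ring.
by ring.
Qed.

Lemma phi_sign_dil4 : fps_sign phi = dil 4 phi - 2 * q * dil 8 psi.
Proof.
rewrite {1}phi_dil4 !fps_signE !fps_sign_dil_even //; ring.
Qed.

(** After [q -> q^2] the left-hand side is [phi(q) phi(-q)], and the 4-dissections of the two
    factors multiply to a difference of squares. *)
Lemma phi_sign_sqr : fps_sign phi ^+ 2 = dil 2 phi ^+ 2 - 4 * q * dil 4 psi ^+ 2.
Proof.
apply: (@dil_inj _ 1).
transitivity (dil 4 phi ^+ 2 - 4 * q ^+ 2 * dil 8 psi ^+ 2); last by rewrite !dilE.
by rewrite dilXn -phi_mul_sign phi_sign_dil4 {1}phi_dil4; ring.
Qed.

Lemma phi_sqr : phi ^+ 2 = dil 2 phi ^+ 2 + 4 * q * dil 4 psi ^+ 2.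
Proof.
have := congr1 (@fps_sign R) phi_sign_sqr.
by rewrite !fps_signE !fps_sign_dil_even // => ->; ring.
Qed.

(** After [q -> q^4] and multiplication by [8 q], both sides equal [phi(q)^2 - phi(-q)^2]: once from
    the formulas for the squares, once by factoring and using the 4-dissections. *)
Lemma psi_sqr : psi ^+ 2 = phi * dil 2 psi.
Proof.
apply: (@dil_inj _ 3); rewrite dilXn dilM dil_dil.
apply: (@fpsX_inj R); apply: (@fps_mulI _ (2 ^+ 3)).
  by rewrite !coef0E !expf_neq0.
transitivity (phi ^+ 2 - fps_sign phi ^+ 2); first by rewrite phi_sqr phi_sign_sqr; ring.
by rewrite phi_sign_dil4 {1}phi_dil4; ring.
Qed.

(** Multiply the defect [d = psi f_1 - f_2^2] by [(psi f_1 + f_2^2) f_4^2]. By [psi_sqr] and [phiE]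
    the product is [f_2^4 (psi(q^2) f_2 - f_4^2) = f_2^4 d(q^2)], so rigidity applies. *)
Lemma psi_gauss : psi * euler = dil 2 euler ^+ 2.
Proof.
have phiE : phi * euler ^+ 2 * dil 4 euler ^+ 2 = dil 2 euler ^+ 5.
  apply: (@fps_mulI _ (dil 2 euler)); first by rewrite !coef0E oner_neq0.
  transitivity ((phi * dil 2 euler) * (euler * dil 4 euler) ^+ 2); first by ring.
  rewrite phi_dil2_gauss.
  transitivity ((euler * fps_sign euler * dil 4 euler) ^+ 2); first by ring.
  by rewrite euler_sign; ring.
apply/eqP; rewrite -subr_eq0; apply/eqP.
apply: (@dil2_rigid _ _ ((psi * euler + dil 2 euler ^+ 2) * dil 4 euler ^+ 2)
  (dil 2 euler ^+ 4)).
- by rewrite !coef0E !expr1n mulr1 subrr.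
- by rewrite !coef0E !expr1n !mulr1.
rewrite !dilE.
transitivity (psi ^+ 2 * euler ^+ 2 * dil 4 euler ^+ 2
  - dil 2 euler ^+ 4 * dil 4 euler ^+ 2); first by ring.
rewrite psi_sqr.
transitivity (dil 2 psi * (phi * euler ^+ 2 * dil 4 euler ^+ 2)
  - dil 2 euler ^+ 4 * dil 4 euler ^+ 2); first by ring.
by rewrite phiE; ring.
Qed.

(** The defect times the sum of the two sides is a difference of squares. Rewriting these squares
    with [psi_sqr], [phi_sqr] and the 4-dissection of [phi] makes the defect at [q^2] appear as a
    factor. *)
Lemma psi_psi3 :
  psi * dil 3 psi = dil 4 psi * dil 6 phi + q * dil 2 phi * dil 12 psi.
Proof.
set t := RHS; apply/eqP; rewrite -subr_eq0; apply/eqP.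
apply: (@dil2_rigid _ _ (psi * dil 3 psi + t) (dil 4 phi * dil 12 phi
  + 4 * q ^+ 4 * dil 8 psi * dil 24 psi - 2 * q * dil 2 psi * dil 6 psi)).
- by rewrite !coef0E !mul0r addr0 mulr1 subrr.
- by rewrite !coef0E !mul0r addr0 mulr1.
have sqr k : dil k.+1 psi ^+ 2 = dil k.+1 phi * dil (k.+1 * 2) psi.
  by have := congr1 (dil k.+1) psi_sqr; rewrite !dilE.
have phi_sqr2 k : dil k.+1 phi ^+ 2
    = dil (k.+1 * 2) phi ^+ 2 + 4 * q ^+ k.+1 * dil (k.+1 * 4) psi ^+ 2.
  by have := congr1 (dil k.+1) phi_sqr; rewrite !dilE.
have phi3E : dil 3 phi = dil 12 phi + 2 * q ^+ 3 * dil 24 psi.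
  by rewrite {1}phi_dil4 !dilE.
have s2 : dil 2 psi ^+ 2 = dil 2 phi * dil 4 psi by apply: sqr.
have s3 : dil 3 psi ^+ 2 = dil 3 phi * dil 6 psi by apply: sqr.
have s4 : dil 4 psi ^+ 2 = dil 4 phi * dil 8 psi by apply: sqr.
have s6 : dil 6 psi ^+ 2 = dil 6 phi * dil 12 psi by apply: sqr.
have s12 : dil 12 psi ^+ 2 = dil 12 phi * dil 24 psi by apply: sqr.
have p2 : dil 2 phi ^+ 2 = dil 4 phi ^+ 2 + 4 * q ^+ 2 * dil 8 psi ^+ 2.
  exact: phi_sqr2.
have p6 : dil 6 phi ^+ 2 = dil 12 phi ^+ 2 + 4 * q ^+ 6 * dil 24 psi ^+ 2.
  exact: phi_sqr2.
rewrite /t !dilE.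
transitivity (psi ^+ 2 * dil 3 psi ^+ 2 - (dil 4 psi ^+ 2 * dil 6 phi ^+ 2
  + q ^+ 2 * dil 2 phi ^+ 2 * dil 12 psi ^+ 2
  + 2 * q * (dil 2 phi * dil 4 psi) * (dil 6 phi * dil 12 psi))).
  by ring.
rewrite -s2 -s6 p2 p6 s3 s4 s12 psi_sqr.
rewrite phi3E [in phi * _]phi_dil4.
by ring.
Qed.

End ThetaIdentities.

(* Here [a], [c], [A], [C], [s] abstract [phi(q)], [psi(q^2)], [phi(q^3)],
   [psi(q^6)] and [psi(q) psi(q^3)]. *)
Section CubicAlgebra.

Variable R : idomainType.
Notation q := (fpsX R).
Variables a c A C s : fps R.
Hypotheses (a0 : coef a 0 = 1) (c0 : coef c 0 = 1) (A0 : coef A 0 = 1).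
Hypothesis s_sqr : s ^+ 2 = a * c * A * C.
Hypothesis cubic1 : a * (c ^+ 2 - q * C ^+ 2) = A * s.
Hypothesis cubic2 : c * (a ^+ 2 - A ^+ 2) = 4 * q * C * s.

Let unit0 := (coefM0, coef0_exp, a0, c0, A0, expr1n, mulr1, oner_neq0).

(** Multiplying [cubic1] by [cubic2] leaves [s] only through [s ^+ 2], which [s_sqr] eliminates;
    then [a * c] cancels. *)
Lemma cubic_quad :
  A ^+ 2 * (c ^+ 2 + 3 * q * C ^+ 2) = a ^+ 2 * (c ^+ 2 - q * C ^+ 2).
Proof.
have E : 4 * q * A ^+ 2 * C ^+ 2 = (c ^+ 2 - q * C ^+ 2) * (a ^+ 2 - A ^+ 2).
  apply: (@fps_mulI _ (a * c)); first by rewrite !unit0.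
  transitivity (4 * q * A * C * s ^+ 2); first by rewrite s_sqr; ring.
  transitivity ((a * (c ^+ 2 - q * C ^+ 2)) * (c * (a ^+ 2 - A ^+ 2))).
    by rewrite cubic1 cubic2; ring.
  by ring.
transitivity (A ^+ 2 * (c ^+ 2 - q * C ^+ 2) + 4 * q * A ^+ 2 * C ^+ 2); first by ring.
by rewrite E; ring.
Qed.

Lemma cubic3 : a * s = A * (c ^+ 2 + 3 * q * C ^+ 2).
Proof.
apply: (@fps_mulI _ A); first by rewrite !unit0.
transitivity (a * (A * s)); first by ring.
rewrite -cubic1; transitivity (A ^+ 2 * (c ^+ 2 + 3 * q * C ^+ 2)); last by ring.
by rewrite cubic_quad; ring.
Qed.

Lemma cubic_prod :
  a * A * c * C = (c ^+ 2 - q * C ^+ 2) * (c ^+ 2 + 3 * q * C ^+ 2).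
Proof.
apply: (@fps_mulI _ (a * A)); first by rewrite !unit0.
transitivity (a * A * s ^+ 2); first by rewrite s_sqr; ring.
transitivity ((a * s) * (A * s)); first by ring.
by rewrite cubic3 -cubic1; ring.
Qed.

(** Squaring [cubic1] removes [s], so [q -> -q] can be applied without knowing its effect on [s];
    [cubic_sqr3] does the same for [cubic3]. *)
Lemma cubic_sqr1 : a * (c ^+ 2 - q * C ^+ 2) ^+ 2 = A ^+ 3 * c * C.
Proof.
apply: (@fps_mulI _ a); first by rewrite !unit0.
transitivity ((a * (c ^+ 2 - q * C ^+ 2)) ^+ 2); first by ring.
rewrite cubic1; transitivity (A ^+ 2 * s ^+ 2); first by ring.
by rewrite s_sqr; ring.
Qed.

Lemma cubic_sqr3 : A * (c ^+ 2 + 3 * q * C ^+ 2) ^+ 2 = a ^+ 3 * c * C.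
Proof.
apply: (@fps_mulI _ A); first by rewrite !unit0.
transitivity ((A * (c ^+ 2 + 3 * q * C ^+ 2)) ^+ 2); first by ring.
rewrite -cubic3; transitivity (a ^+ 2 * s ^+ 2); first by ring.
by rewrite s_sqr; ring.
Qed.

Hypothesis s0 : coef s 0 = 1.

(** Turns the theta combination in the odd part of [F] into a combination of [a^2 c^2] and
    [q A^2 C^2], which are [psi(q)^4] and [q psi(q^3)^4]. The term [a^3 c C] created by [s ^+ 2] is
    removed with [cubic_sqr3]. *)
Lemma odd_mass : s * (4 * c ^+ 3 * A + a ^+ 3 * C) =
  A * C * (5 * a ^+ 2 * c ^+ 2 - 9 * q * A ^+ 2 * C ^+ 2).
Proof.
apply: (@fps_mulI _ s); first by rewrite s0 oner_neq0.
transitivity (s ^+ 2 * (4 * c ^+ 3 * A + a ^+ 3 * C)); first by ring.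
rewrite s_sqr.
transitivity (A * C * (4 * a * c ^+ 4 * A + a * (a ^+ 3 * c * C))); first by ring.
rewrite -cubic_sqr3.
transitivity (A * C * (5 * a * c ^+ 2 * (a * s) - 9 * q * A * C ^+ 2 * (A * s))).
  by rewrite cubic3 -cubic1; ring.
by ring.
Qed.

(** The counterpart of [odd_mass] for the even part of [G]; here [cubic1] and [cubic2] absorb [s]
    directly. *)
Lemma even_mass : s * (A ^+ 3 * c + 4 * q ^+ 2 * C ^+ 3 * a) =
  a * c * (a ^+ 2 * c ^+ 2 - 5 * q * A ^+ 2 * C ^+ 2).
Proof.
transitivity (A ^+ 2 * c * (A * s) + q * a * C ^+ 2 * (4 * q * C * s)); first by ring.
rewrite -cubic1 -cubic2.
transitivity (a * c * (A ^+ 2 * (c ^+ 2 + 3 * q * C ^+ 2) - 5 * q * A ^+ 2 * C ^+ 2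
  + q * a ^+ 2 * C ^+ 2)); first by ring.
by rewrite cubic_quad; ring.
Qed.

(** After multiplication by [a * A], [cubic1] removes [s] and [cubic_prod] factors [a A c C];
    [cubic_quad] then replaces the terms in [A ^+ 2]. The proof of [mass3] is parallel. *)
Lemma mass1 : s * (c ^+ 2 + q * C ^+ 2) ^+ 2 =
  c * C * (a ^+ 2 * c ^+ 2 - q * A ^+ 2 * C ^+ 2).
Proof.
apply: (@fps_mulI _ (a * A)); first by rewrite !unit0.
transitivity (a * (c ^+ 2 + q * C ^+ 2) ^+ 2 * (A * s)); first by ring.
rewrite -cubic1.
transitivity ((a * A * c * C) * (a ^+ 2 * c ^+ 2 - q * A ^+ 2 * C ^+ 2)); last by ring.
rewrite cubic_prod.
transitivity ((c ^+ 2 - q * C ^+ 2) * (a ^+ 2 * c ^+ 2 * (c ^+ 2 + 3 * q * C ^+ 2)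
   - q * C ^+ 2 * (A ^+ 2 * (c ^+ 2 + 3 * q * C ^+ 2)))); last by ring.
by rewrite cubic_quad; ring.
Qed.

Lemma mass3 : s * (c ^+ 2 - 3 * q * C ^+ 2) ^+ 2 =
  c * C * (a ^+ 2 * c ^+ 2 - 9 * q * A ^+ 2 * C ^+ 2).
Proof.
apply: (@fps_mulI _ (a * A)); first by rewrite !unit0.
transitivity (a * (c ^+ 2 - 3 * q * C ^+ 2) ^+ 2 * (A * s)); first by ring.
rewrite -cubic1.
transitivity ((a * A * c * C) * (a ^+ 2 * c ^+ 2 - 9 * q * A ^+ 2 * C ^+ 2));
  last by ring.
rewrite cubic_prod.
transitivity ((c ^+ 2 - q * C ^+ 2) * (a ^+ 2 * c ^+ 2 * (c ^+ 2 + 3 * q * C ^+ 2)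
   - 9 * q * C ^+ 2 * (A ^+ 2 * (c ^+ 2 + 3 * q * C ^+ 2)))); last by ring.
by rewrite cubic_quad; ring.
Qed.

End CubicAlgebra.

(* In addition to the above, [b], [B], [p], [r] abstract [phi(-q)], [phi(-q^3)],
   [psi(q)], [psi(q^3)], and [f_k] is Euler's product at [q^k]. *)
Section EtaAlgebra.

Variable R : idomainType.
Notation q := (fpsX R).
Variables a b c A B C p r f1 f2 f3 f6 : fps R.
Hypotheses (a0 : coef a 0 = 1) (b0 : coef b 0 = 1) (c0 : coef c 0 = 1).
Hypotheses (A0 : coef A 0 = 1) (B0 : coef B 0 = 1) (C0 : coef C 0 = 1).
Hypotheses (p0 : coef p 0 = 1) (r0 : coef r 0 = 1) (f10 : coef f1 0 = 1).
Hypotheses (f20 : coef f2 0 = 1) (f30 : coef f3 0 = 1) (f60 : coef f6 0 = 1).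
Hypotheses (p_sqr : p ^+ 2 = a * c) (r_sqr : r ^+ 2 = A * C).
Hypotheses (f1_sqr : f1 ^+ 2 = b * f2) (f3_sqr : f3 ^+ 2 = B * f6).
Hypotheses (f2_sqr : f2 ^+ 2 = p * f1) (f6_sqr : f6 ^+ 2 = r * f3).
Hypothesis cubic1 : a * (c ^+ 2 - q * C ^+ 2) = A * (p * r).
Hypothesis cubic2 : c * (a ^+ 2 - A ^+ 2) = 4 * q * C * (p * r).
Hypothesis sqr1 : b * (c ^+ 2 + q * C ^+ 2) ^+ 2 = B ^+ 3 * c * C.
Hypothesis sqr3 : B * (c ^+ 2 - 3 * q * C ^+ 2) ^+ 2 = b ^+ 3 * c * C.

Let unit0 := (coefM0, coef0_exp, a0, b0, c0, A0, B0, C0, p0, r0, f10, f20, f30, f60,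
  expr1n, mulr1, oner_neq0).

Let s_sqr : (p * r) ^+ 2 = a * c * A * C.
Proof. by rewrite exprMn p_sqr r_sqr; ring. Qed.

Let s0 : coef (p * r) 0 = 1.
Proof. by rewrite !unit0. Qed.

Let f2_cube : f2 ^+ 3 = a * b * c.
Proof.
apply: (@fps_mulI _ f2); first by rewrite !unit0.
transitivity ((f2 ^+ 2) ^+ 2); first by ring.
rewrite f2_sqr; transitivity (p ^+ 2 * f1 ^+ 2); first by ring.
by rewrite p_sqr f1_sqr; ring.
Qed.

Let f6_cube : f6 ^+ 3 = A * B * C.
Proof.
apply: (@fps_mulI _ f6); first by rewrite !unit0.
transitivity ((f6 ^+ 2) ^+ 2); first by ring.
rewrite f6_sqr; transitivity (r ^+ 2 * f3 ^+ 2); first by ring.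
by rewrite r_sqr f3_sqr; ring.
Qed.

(** The square of [c^2 + q C^2] occurs in both [mass1] and [sqr1]; eliminating it gives [sB]. The
    Gauss products then translate [sB] into Euler products. *)
Lemma eta_mass1 : f2 ^+ 3 * f6 ^+ 3 * f3 ^+ 3 =
  f1 ^+ 3 * r ^+ 2 * (p ^+ 4 - q * r ^+ 4).
Proof.
have sB : p * r * B ^+ 3 = b * (a ^+ 2 * c ^+ 2 - q * A ^+ 2 * C ^+ 2).
  apply: (@fps_mulI _ (c * C)); first by rewrite !unit0.
  transitivity (p * r * (B ^+ 3 * c * C)); first by ring.
  rewrite -sqr1.
  transitivity (b * (c * C * (a ^+ 2 * c ^+ 2 - q * A ^+ 2 * C ^+ 2))); last by ring.
  by rewrite -(mass1 a0 c0 A0 s_sqr cubic1 cubic2); ring.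
apply: (@fps_mulI _ (p * r * f1)); first by rewrite !unit0.
transitivity (f2 ^+ 3 * f6 ^+ 3 * f3 ^+ 2 * (p * f1) * (r * f3)); first by ring.
rewrite -f2_sqr -f6_sqr f3_sqr.
transitivity ((f1 ^+ 2) ^+ 2 * (p * r) * r ^+ 2 * ((p ^+ 2) ^+ 2 - q * (r ^+ 2) ^+ 2)).
  rewrite f1_sqr p_sqr r_sqr.
  transitivity (b * f2 ^+ 2 * A * C * (p * r)
    * (b * (a ^+ 2 * c ^+ 2 - q * A ^+ 2 * C ^+ 2))); last by ring.
  rewrite -sB; transitivity (b * f2 ^+ 2 * A * C * (p * r) ^+ 2 * B ^+ 3); last by ring.
  rewrite s_sqr; transitivity (f2 ^+ 2 * f2 ^+ 3 * (f6 ^+ 3) ^+ 2 * B); first by ring.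
  by rewrite f2_cube f6_cube; ring.
by ring.
Qed.

(** As for [eta_mass1], with the square of [c^2 - 3 q C^2] eliminated between [mass3] and [sqr3]. *)
Lemma eta_mass3 : f1 ^+ 4 * f2 * f6 * r = f3 ^+ 2 * p * (p ^+ 4 - 9 * q * r ^+ 4).
Proof.
have sb : p * r * b ^+ 3 = B * (a ^+ 2 * c ^+ 2 - 9 * q * A ^+ 2 * C ^+ 2).
  apply: (@fps_mulI _ (c * C)); first by rewrite !unit0.
  transitivity (p * r * (b ^+ 3 * c * C)); first by ring.
  rewrite -sqr3.
  transitivity (B * (c * C * (a ^+ 2 * c ^+ 2 - 9 * q * A ^+ 2 * C ^+ 2))); last by ring.
  by rewrite -(mass3 a0 c0 A0 s_sqr cubic1 cubic2); ring.
transitivity ((f1 ^+ 2) ^+ 2 * f2 * f6 * r); first by ring.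
rewrite f1_sqr f3_sqr.
transitivity (f6 * p * (B * ((p ^+ 2) ^+ 2 - 9 * q * (r ^+ 2) ^+ 2))); last by ring.
transitivity (b ^+ 2 * f2 ^+ 3 * f6 * r); first by ring.
rewrite p_sqr r_sqr f2_cube.
transitivity (f6 * p * (B * (a ^+ 2 * c ^+ 2 - 9 * q * A ^+ 2 * C ^+ 2))); last by ring.
by rewrite -sb; transitivity (f6 * p ^+ 2 * r * b ^+ 3); [rewrite p_sqr|]; ring.
Qed.

(** Multiplied by [p * r], both sides become [- f_1^3 f_3 r^2 (5 p^4 - 9 q r^4)], the right one by
    [odd_mass] and the left one by [eta_mass1]. *)
Lemma eta_odd_part : f2 * f6 * (4 * f2 ^+ 5 * f6 - 9 * f1 * f3 ^+ 5) =
  - (f1 ^+ 3 * f3 * (4 * c ^+ 3 * A + a ^+ 3 * C)).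
Proof.
apply: (@fps_mulI _ (p * r)); first by rewrite s0 oner_neq0.
transitivity (- (f1 ^+ 3 * f3 * (p * r * (4 * c ^+ 3 * A + a ^+ 3 * C)))); last by ring.
rewrite (odd_mass a0 c0 A0 s_sqr cubic1 cubic2 s0).
transitivity (- (f1 ^+ 3 * f3 * r ^+ 2 * (5 * (p ^+ 2) ^+ 2 - 9 * q * (r ^+ 2) ^+ 2)));
  last by rewrite p_sqr r_sqr; ring.
transitivity (4 * p * r * (f2 ^+ 2) ^+ 3 * f6 ^+ 2
  - 9 * (p * f1) * (r * f3) * f2 * f6 * f3 ^+ 4); first by ring.
rewrite -f2_sqr -f6_sqr.
transitivity (4 * p * r * (f2 ^+ 2) ^+ 3 * f6 ^+ 2
  - 9 * f3 * (f2 ^+ 3 * f6 ^+ 3 * f3 ^+ 3)); first by ring.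
by rewrite eta_mass1 f2_sqr f6_sqr; ring.
Qed.

(** Multiplied by [p * r], both sides become [f_1 f_3^3 p^2 (p^4 - 5 q r^4)], by [even_mass] and
    [eta_mass3]. *)
Lemma eta_even_part : f2 * f6 * (f1 ^+ 5 * f3 + 4 * q * f2 * f6 ^+ 5) =
  f1 * f3 ^+ 3 * (A ^+ 3 * c + 4 * q ^+ 2 * C ^+ 3 * a).
Proof.
apply: (@fps_mulI _ (p * r)); first by rewrite s0 oner_neq0.
transitivity (f1 * f3 ^+ 3 * (p * r * (A ^+ 3 * c + 4 * q ^+ 2 * C ^+ 3 * a)));
  last by ring.
rewrite (even_mass a0 c0 s_sqr cubic1 cubic2).
transitivity (f1 * f3 ^+ 3 * p ^+ 2 * ((p ^+ 2) ^+ 2 - 5 * q * (r ^+ 2) ^+ 2));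
  last by rewrite p_sqr r_sqr; ring.
transitivity ((f1 ^+ 4 * f2 * f6 * r) * (p * f1) * f3
  + 4 * q * p * r * f2 ^+ 2 * (f6 ^+ 2) ^+ 3); first by ring.
by rewrite eta_mass3 f6_sqr f2_sqr; ring.
Qed.

End EtaAlgebra.

(** * Two-dissections *)

Section Dissection.

Variable R : idomainType.
Hypothesis two_neq0 : 2 != 0 :> R.
Notation q := (fpsX R).
Notation phi := (phi R).
Notation psi := (psi R).
Notation euler := (euler R).

(** The two defects are coupled: each one, times a series of constant term [1], is a combination of
    both defects at [q^2]. Hence they vanish together by [dil2_rigid2]. *)
Lemma theta_cubic :
  phi * (dil 2 psi ^+ 2 - q * dil 6 psi ^+ 2) = dil 3 phi * (psi * dil 3 psi) /\
  dil 2 psi * (phi ^+ 2 - dil 3 phi ^+ 2) = 4 * q * dil 6 psi * (psi * dil 3 psi).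
Proof.
have psi_sqr := psi_sqr two_neq0; have phi_sqr := phi_sqr R.
have p3_sqr : dil 3 psi ^+ 2 = dil 3 phi * dil 6 psi.
  by have := congr1 (dil 3) psi_sqr; rewrite !dilE.
have c_sqr : dil 2 psi ^+ 2 = dil 2 phi * dil 4 psi.
  by have := congr1 (dil 2) psi_sqr; rewrite !dilE.
have C_sqr : dil 6 psi ^+ 2 = dil 6 phi * dil 12 psi.
  by have := congr1 (dil 6) psi_sqr; rewrite !dilE.
have A_sqr : dil 3 phi ^+ 2 = dil 6 phi ^+ 2 + 4 * q ^+ 3 * dil 12 psi ^+ 2.
  by have := congr1 (dil 3) phi_sqr; rewrite !dilE.
have sE := psi_psi3 two_neq0.
have s_sqr : (psi * dil 3 psi) ^+ 2 = phi * dil 3 phi * dil 2 psi * dil 6 psi.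
  by rewrite exprMn psi_sqr p3_sqr; ring.
pose d1 := phi * (dil 2 psi ^+ 2 - q * dil 6 psi ^+ 2) - dil 3 phi * (psi * dil 3 psi).
pose d2 := dil 2 psi * (phi ^+ 2 - dil 3 phi ^+ 2)
  - 4 * q * dil 6 psi * (psi * dil 3 psi).
suff [] : d1 = 0 /\ d2 = 0.
  by rewrite /d1 /d2 => /eqP + /eqP; rewrite !subr_eq0 => /eqP -> /eqP ->.
apply: (@dil2_rigid2 _ _ _ (psi * dil 3 psi) (dil 2 psi)
  (phi * dil 6 phi) (phi * q * dil 12 psi) (4 * q * dil 4 psi) (dil 2 phi)).
- by rewrite !coef0E !expr1n ?(mulr1, mul1r, mul0r, mulr0, subr0, subrr).
- by rewrite !coef0E !expr1n ?(subrr, mulr0, mul0r, subr0).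
- by rewrite !coef0E mulr1 oner_neq0.
- by rewrite !coef0E oner_neq0.
- rewrite /d1 /d2 !dilE.
  transitivity (phi * ((psi * dil 3 psi) * (dil 2 psi ^+ 2 - q * dil 6 psi ^+ 2))
    - dil 3 phi * (psi * dil 3 psi) ^+ 2); first by ring.
  rewrite s_sqr.
  transitivity (phi * ((psi * dil 3 psi) * (dil 2 psi ^+ 2 - q * dil 6 psi ^+ 2)
    - dil 3 phi ^+ 2 * dil 2 psi * dil 6 psi)); first by ring.
  by rewrite A_sqr c_sqr C_sqr sE; ring.
rewrite /d1 /d2 !dilE sE.
transitivity (dil 2 psi ^+ 2 * (phi ^+ 2 - dil 3 phi ^+ 2)
  - 4 * q * (dil 2 psi * dil 6 psi)
  * (dil 4 psi * dil 6 phi + q * dil 2 phi * dil 12 psi)); first by ring.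
by rewrite A_sqr phi_sqr c_sqr; ring.
Qed.

Let a := phi.
Let b := fps_sign phi.
Let c := dil 2 psi.
Let A := dil 3 phi.
Let B := dil 3 (fps_sign phi).
Let C := dil 6 psi.
Let p := psi.
Let r := dil 3 psi.
Let f1 := euler.
Let f2 := dil 2 euler.
Let f3 := dil 3 euler.
Let f6 := dil 6 euler.

Let a0 : coef a 0 = 1. Proof. by rewrite /a coef0E. Qed.
Let b0 : coef b 0 = 1. Proof. by rewrite /b !coef0E. Qed.
Let c0 : coef c 0 = 1. Proof. by rewrite /c !coef0E. Qed.
Let A0 : coef A 0 = 1. Proof. by rewrite /A !coef0E. Qed.
Let B0 : coef B 0 = 1. Proof. by rewrite /B !coef0E. Qed.
Let C0 : coef C 0 = 1. Proof. by rewrite /C !coef0E. Qed.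
Let p0 : coef p 0 = 1. Proof. by rewrite /p !coef0E. Qed.
Let r0 : coef r 0 = 1. Proof. by rewrite /r !coef0E. Qed.
Let f10 : coef f1 0 = 1. Proof. by rewrite /f1 !coef0E. Qed.
Let f20 : coef f2 0 = 1. Proof. by rewrite /f2 !coef0E. Qed.
Let f30 : coef f3 0 = 1. Proof. by rewrite /f3 !coef0E. Qed.
Let f60 : coef f6 0 = 1. Proof. by rewrite /f6 !coef0E. Qed.
Let p_sqr : p ^+ 2 = a * c. Proof. exact: psi_sqr. Qed.
Let r_sqr : r ^+ 2 = A * C.
Proof. by have := congr1 (dil 3) (psi_sqr two_neq0); rewrite !dilE. Qed.
Let f1_sqr : f1 ^+ 2 = b * f2. Proof. by rewrite phi_gauss. Qed.
Let f3_sqr : f3 ^+ 2 = B * f6.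
Proof. by have := congr1 (dil 3) (phi_gauss R); rewrite !dilE. Qed.
Let f2_sqr : f2 ^+ 2 = p * f1. Proof. by rewrite psi_gauss. Qed.
Let f6_sqr : f6 ^+ 2 = r * f3.
Proof. by have := congr1 (dil 3) (psi_gauss two_neq0); rewrite !dilE. Qed.
Let cubic1 : a * (c ^+ 2 - q * C ^+ 2) = A * (p * r).
Proof. by case: theta_cubic. Qed.
Let cubic2 : c * (a ^+ 2 - A ^+ 2) = 4 * q * C * (p * r).
Proof. by case: theta_cubic. Qed.
Let s_sqr : (p * r) ^+ 2 = a * c * A * C.
Proof. by rewrite exprMn p_sqr r_sqr; ring. Qed.
Let signA : fps_sign A = B. Proof. by rewrite /A /B fps_sign_dil_odd. Qed.
Let signc : fps_sign c = c. Proof. by rewrite /c fps_sign_dil_even. Qed.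
Let signC : fps_sign C = C. Proof. by rewrite /C fps_sign_dil_even. Qed.
(** The image of [cubic_sqr1] under [q -> -q], which fixes the even series [c] and [C] and exchanges
    [a], [A] for [b], [B]. *)
Let sqr1 : b * (c ^+ 2 + q * C ^+ 2) ^+ 2 = B ^+ 3 * c * C.
Proof.
have := congr1 (@fps_sign R) (cubic_sqr1 a0 s_sqr cubic1).
rewrite !fps_signE signA signc signC -/b => <-; ring.
Qed.
Let sqr3 : B * (c ^+ 2 - 3 * q * C ^+ 2) ^+ 2 = b ^+ 3 * c * C.
Proof.
have := congr1 (@fps_sign R) (cubic_sqr3 a0 c0 A0 s_sqr cubic1 cubic2).
rewrite !fps_signE signA signc signC -/b => <-; ring.
Qed.

Definition eta51 : fps R := euler ^+ 5 * dil 3 euler.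
Definition eta15 : fps R := euler * dil 3 euler ^+ 5.

Lemma coef_parity_even (u v : fps R) n :
  coef (dil 2 u + q * dil 2 v) n.*2 = coef u n.
Proof.
rewrite coefD coefXM coef_dil dvdn2 odd_double divn2 doubleK.
by case: n => [|n]; rewrite ?addr0 // doubleS coef_dil dvdn2 /= odd_double addr0.
Qed.

Lemma coef_parity_odd (u v : fps R) n :
  coef (dil 2 u + q * dil 2 v) n.*2.+1 = coef v n.
Proof.
by rewrite coefD coefXM !coef_dil !dvdn2 /= odd_double /= divn2 doubleK add0r.
Qed.

Lemma parity_split (u : fps R) : u = dil 2 (Fps (fun n => coef u n.*2))
  + q * dil 2 (Fps (fun n => coef u n.*2.+1)).
Proof.
apply: fpsP => n; rewrite -(odd_double_half n).
by case: (odd n); rewrite ?(add1n, add0n) ?coef_parity_odd ?coef_parity_even.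
Qed.

Lemma parity_inj (x y x' y' : fps R) :
  dil 2 x + q * dil 2 y = dil 2 x' + q * dil 2 y' -> x = x' /\ y = y'.
Proof.
move=> xy; split; apply: fpsP => n.
  by rewrite -(coef_parity_even x y) xy coef_parity_even.
by rewrite -(coef_parity_odd x y) xy coef_parity_odd.
Qed.

(** Multiplication by the even series [g(q^2)] preserves parity classes, so the odd part may be
    compared after this multiplication and [g] cancelled. *)
Lemma odd_part (g u v w : fps R) : coef g 0 != 0 ->
  dil 2 g * u = dil 2 v + q * dil 2 (g * w) -> forall n, coef u n.*2.+1 = coef w n.
Proof.
move=> g0; rewrite {1}(parity_split u) mulrDr mulrCA -!dilM => /parity_inj[_].
by move=> /(fps_mulI g0) <- n.
Qed.

Lemma even_part (g u v w : fps R) : coef g 0 != 0 ->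
  dil 2 g * u = dil 2 (g * w) + q * dil 2 v -> forall n, coef u n.*2 = coef w n.
Proof.
move=> g0; rewrite {1}(parity_split u) mulrDr mulrCA -!dilM => /parity_inj[+ _].
by move=> /(fps_mulI g0) <- n.
Qed.

Let dilc : dil 2 phi ^+ 2 - 4 * q * dil 2 c ^+ 2 = b ^+ 2.
Proof. by rewrite /c dil_dil phi_sign_sqr. Qed.

Let dilC : dil 2 A ^+ 2 - 4 * q ^+ 3 * dil 2 C ^+ 2 = B ^+ 2.
Proof.
have := congr1 (dil 3) (phi_sign_sqr R).
by rewrite /A /C !dilE => <-.
Qed.

(** Since [psi(-q) f_2 = f_1 f_4], the left-hand side is [f_2 f_6 psi(-q) psi(-q^3)], and [psi_psi3]
    at [-q] dissects the last two factors. *)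
Let euler_euler3 : dil 2 (f2 * f6) * (f1 * f3) =
  f2 * f6 * (dil 2 c * dil 2 A - q * dil 2 a * dil 2 C).
Proof.
have sign_psi : fps_sign psi * f2 = f1 * dil 4 euler.
  apply: (fps_sqr_inj two_neq0); try by rewrite /f1 /f2 !coef0E mulr1.
  have p2 : fps_sign psi ^+ 2 = b * c.
    have := congr1 (@fps_sign R) p_sqr.
    by rewrite !fps_signE signc.
  have cf : c * f2 = dil 4 euler ^+ 2.
    by have := congr1 (dil 2) (psi_gauss two_neq0); rewrite !dilE.
  rewrite !exprMn p2 f1_sqr -cf; ring.
have sign_psi3 : fps_sign r * f6 = f3 * dil 12 euler.
  have := congr1 (dil 3) sign_psi.
  by rewrite /r fps_sign_dil_odd // /f2 /f1 !dilE.
have signE : fps_sign psi * fps_sign r = dil 2 c * dil 2 A - q * dil 2 a * dil 2 C.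
  have := congr1 (@fps_sign R) (psi_psi3 two_neq0).
  rewrite !fps_signE !(fps_sign_dil_even _ (k := 2)) //.
  rewrite !(fps_sign_dil_even _ (k := 4)) //.
  rewrite !(fps_sign_dil_even _ (k := 6)) // !(fps_sign_dil_even _ (k := 12)) //.
  rewrite -/r /a /A /c /C !dil_dil => ->; ring.
rewrite -signE dilM /f2 /f6 !dil_dil -/f2 -/f6.
transitivity ((f1 * dil 4 euler) * (f3 * dil 12 euler)); first by ring.
by rewrite -sign_psi -sign_psi3; ring.
Qed.

(** Write [F = f_1 f_3 (f_1^2)^2] with [f_1^2 = phi(-q) f_2]: [euler_euler3] and [dilc] dissect the
    factors, and [eta_odd_part] recognises the odd half of the product. *)
Lemma eta51_odd n :
  coef eta51 n.*2.+1 = coef (4 * dil 2 eta51 - 9 * eta15) n.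
Proof.
apply: (@odd_part (f2 * f6) _
  (f1 ^+ 3 * f3 * (a ^+ 2 * c * A + 4 * q * c ^+ 2 * a * C))).
  by rewrite coefM0 f20 f60 mulr1 oner_neq0.
have -> : f2 * f6 * (4 * dil 2 eta51 - 9 * eta15) =
    - (f1 ^+ 3 * f3 * (4 * c ^+ 3 * A + a ^+ 3 * C)).
  rewrite /eta51 /eta15 !dilE -/f2 -/f6 -/f1 -/f3.
  rewrite -[RHS](eta_odd_part a0 c0 A0 C0 p0 r0 f10 f20 f60 p_sqr r_sqr f1_sqr
    f3_sqr f2_sqr f6_sqr cubic1 cubic2 sqr1); ring.
transitivity (dil 2 (f2 * f6) * (f1 * f3) * (f1 ^+ 2) ^+ 2).
  by rewrite /eta51 -/f1 -/f3; ring.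
rewrite euler_euler3 f1_sqr exprMn -dilc !dilE -/f2.
rewrite -/a -[dil (2 * 3) euler]/f6.
by ring.
Qed.

(** Same scheme for [G = f_1 f_3 (f_3^2)^2], with [dilC] and [eta_even_part]. *)
Lemma eta15_even n :
  coef eta15 n.*2 = coef (eta51 + 4 * q * dil 2 eta15) n.
Proof.
apply: (@even_part (f2 * f6) _
  (- (f1 * f3 ^+ 3 * (A ^+ 2 * a * C + 4 * q * C ^+ 2 * c * A)))).
  by rewrite coefM0 f20 f60 mulr1 oner_neq0.
have -> : f2 * f6 * (eta51 + 4 * q * dil 2 eta15) =
    f1 * f3 ^+ 3 * (A ^+ 3 * c + 4 * q ^+ 2 * C ^+ 3 * a).
  rewrite /eta51 /eta15 !dilE -/f2 -/f6 -/f1 -/f3.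
  rewrite -[RHS](eta_even_part a0 c0 A0 C0 p0 r0 f20 p_sqr r_sqr f1_sqr
    f3_sqr f2_sqr f6_sqr cubic1 cubic2 sqr3); ring.
transitivity (dil 2 (f2 * f6) * (f1 * f3) * (f3 ^+ 2) ^+ 2).
  by rewrite /eta15 -/f1 -/f3; ring.
rewrite euler_euler3 f3_sqr exprMn -dilC !dilE -/f2.
rewrite -/a -[dil (2 * 3) euler]/f6.
by ring.
Qed.

End Dissection.

(** * Recurrences for the coefficients of [F] along [n -> 4 n + 1] *)

Section Recurrence.

Variable R : idomainType.
Hypothesis two_neq0 : 2 != 0 :> R.

Let u n := coef (eta51 R) n.
Let v n := coef (eta15 R) n.

Let coef_natl k (w : fps R) n : coef (k%:R * w) n = k%:R * coef w n.
Proof. by rewrite !mulr_natl coefMn. Qed.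

Let u_4n1 n : u (4 * n).+1 = 4 * u n - 9 * v n.*2.
Proof.
rewrite -[(4 * n)%N]/(2 * 2 * n)%N -mulnA !mul2n /u eta51_odd // coefD coefN.
by rewrite !coef_natl coef_dil dvdn2 odd_double divn2 doubleK.
Qed.

Let u_4n3 n : u (4 * n + 3) = - 9 * v n.*2.+1.
Proof.
have -> : (4 * n + 3 = n.*2.+1.*2.+1)%N by rewrite -!muln2; ring.
rewrite /u eta51_odd // coefD coefN !coef_natl coef_dil.
have -> : (2 %| n.*2.+1)%N = false by rewrite dvdn2 /= odd_double.
by rewrite /v; ring.
Qed.

Let u_8n5 n : u (8 * n + 5) = - 5 * u n.*2.+1 - 36 * v n.
Proof.
have -> : (8 * n + 5 = (4 * n.*2.+1).+1)%N by rewrite -!muln2; ring.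
rewrite u_4n1 {1}/v eta15_even // coefD -mulrA coef_natl coefXM coef_dil.
by rewrite dvdn2 odd_double divn2 doubleK -/(u _) -/(v _) /=; ring.
Qed.

(** Eliminate [v n.*2] between [u_8n5] at [n.*2] and [u_4n1] at [n]. *)
Lemma eta51_rec n : u (16 * n + 5) = - u (4 * n).+1 - 16 * u n.
Proof.
have -> : (16 * n + 5 = 8 * n.*2 + 5)%N by rewrite -!muln2; ring.
rewrite u_8n5; have -> : (n.*2.*2.+1 = (4 * n).+1)%N by rewrite -!muln2; ring.
have := u_4n1 n; set w := v _; set x := u _ => ->; ring.
Qed.

Lemma eta51_rec3 n : u (16 * n + 13) = - u (4 * n + 3).
Proof.
have -> : (16 * n + 13 = 8 * n.*2.+1 + 5)%N by rewrite -!muln2; ring.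
rewrite u_8n5; have -> : (n.*2.+1.*2.+1 = 4 * n + 3)%N by rewrite -!muln2; ring.
by rewrite u_4n3; ring.
Qed.

Let step n := (4 * n).+1.

Lemma eta51_iter7 n : 7 = 0 :> R -> u (iter 7 step n) = 3 * u n.
Proof.
move=> seven0.
have rec m : u (step (step m)) = - u (step m) - 16 * u m.
  by rewrite -eta51_rec /step; congr u; ring.
(* Modulo [t^2 + t + 16] one has [t^7 = 11280 - 2639 t], where [11280 = 3 + 7 * 1611] and
   [2639 = 7 * 377]. *)
transitivity (3 * u n + 7 * (1611 * u n - 377 * u (step n))).
  by rewrite /= !rec; ring.
by rewrite seven0 mul0r addr0.
Qed.

Lemma eta51_iter6 n : 7 = 0 :> R -> u (iter 6 step (4 * n + 3)) = 0.
Proof.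
move=> seven0.
have rec m : u (step (step m)) = - u (step m) - 16 * u m.
  by rewrite -eta51_rec /step; congr u; ring.
have rec3 : u (step (4 * n + 3)) = - u (4 * n + 3).
  by rewrite -eta51_rec3 /step; congr u; ring.
(* Here [t^6 = - 705 t - 3344], and the first step from [4 n + 3] multiplies by [-1]; at [t = -1]
   this is [- 2639 = - 7 * 377]. *)
transitivity (7 * (- 377 * u (4 * n + 3))); last by rewrite seven0 mul0r.
by rewrite /= !rec rec3; ring.
Qed.

End Recurrence.

(** * Counting regular partitions *)

Section RegularPartitions.

Local Open Scope nat_scope.

(** The bound [k] on the parts is the induction parameter that builds the product formula one factor
    at a time. *)
Definition regular_le l k n : seq (seq nat) :=
  [seq s <- [seq parts t | t <- enum {: {bseq n of 'I_n.+1}}]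
     | [&& is_regular l s, all (leq^~ k) s & sumn s == n]].

Lemma regular_le_uniq l k n : uniq (regular_le l k n).
Proof. by rewrite filter_uniq // map_inj_uniq ?enum_uniq //; apply: parts_inj. Qed.

Lemma mem_regular_le l k n s : (s \in regular_le l k n) =
  [&& is_regular l s, all (leq^~ k) s & sumn s == n].
Proof.
rewrite mem_filter andb_idr // => /and3P[/andP[s_part _] _ /eqP s_sum].
have [|t <-] := partsP s_part (n := n); first by rewrite s_sum.
by apply: map_f; rewrite mem_enum.
Qed.

Lemma geq_trans : transitive geq.
Proof. by move=> y x z /= yx zy; apply: leq_trans zy yx. Qed.

Lemma sumn_ge (s : seq nat) x : x \in s -> (x <= sumn s).
Proof. by move=> /perm_to_rem/perm_sumn ->; apply: leq_addr. Qed.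

Lemma size_regular_le l k n : (n <= k) ->
  size (regular_le l k n) = size (regular_le l n n).
Proof.
move=> nk; apply/perm_size/uniq_perm; rewrite ?regular_le_uniq // => s.
rewrite !mem_regular_le; congr (_ && _); case: eqP => [s_sum|]; rewrite ?andbF //.
rewrite !andbT; apply/allP/allP => s_le x /[dup] xs /s_le // _.
  by rewrite /= -s_sum; apply: sumn_ge.
by rewrite /= (leq_trans _ nk) // -s_sum; apply: sumn_ge.
Qed.

Lemma size_regular_le0 l n : size (regular_le l 0 n) = (n == 0).
Proof.
have -> : size (regular_le l 0 n) =
    size (if n == 0 then [:: [::]] else [::] : seq (seq nat)).
  apply/perm_size/uniq_perm; rewrite ?regular_le_uniq //; first by case: ifP.
  move=> s; rewrite mem_regular_le.
  case: s => [|x s] /=.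
    by rewrite [in LHS]eq_sym; case: ifP.
  have -> : ((x :: s) \in if n == 0 then [:: [::]] else [::] : seq (seq nat)) = false.
    by case: ifP.
  by rewrite /is_regular /is_partition /=; case: x => [|x]; rewrite ?andbF.
by case: ifP.
Qed.

(** Either [k.+1] is not a part, or it is the first part by monotonicity and deleting it leaves a
    partition of [n - k.+1]. *)
Lemma size_regular_leS l k n : size (regular_le l k.+1 n) =
  (size (regular_le l k n) + if ~~ (l %| k.+1) && (k < n)
     then size (regular_le l k.+1 (n - k.+1)) else 0).
Proof.
set c := (_ && _).
have -> : (if c then size (regular_le l k.+1 (n - k.+1)) else 0) =
    size (if c then map (cons k.+1) (regular_le l k.+1 (n - k.+1)) else [::]).
  by case: c; rewrite ?size_map.
rewrite -size_cat; apply/perm_size/uniq_perm; rewrite ?regular_le_uniq //.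
  rewrite cat_uniq regular_le_uniq /=; case: c => //=.
  rewrite map_inj_uniq ?regular_le_uniq ?andbT; last by move=> x y [].
  apply/hasPn => _ /mapP[s _ ->]; rewrite mem_regular_le /= ltnn.
  by rewrite andbF.
move=> s; rewrite mem_cat !mem_regular_le.
have [/andP[lk kn]|/negP notc] := boolP c; last first.
  rewrite orbF; apply: andb_id2l => /andP[/andP[_ _] s_reg].
  apply: andb_id2r => /eqP s_sum; apply/allP/allP => s_le x /[dup] xs /s_le.
    rewrite /= leq_eqVlt => /orP[/eqP xk|//]; case: notc; rewrite /c -xk.
    by rewrite (allP s_reg) //= -s_sum; apply: sumn_ge.
  exact: leqW.
apply/idP/orP => [/and3P[s_reg s_le /eqP s_sum]|[]].
- have [s_lek|s_gt] := boolP (all (leq^~ k) s); first by left; rewrite s_reg s_sum eqxx.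
  right; case: s s_reg s_le s_sum s_gt => // x s.
  rewrite {1}/is_regular /is_partition /= path_sortedE; last exact: geq_trans.
  case/andP=> /andP[/andP[/allP x_ge s_sort] /andP[_ s_gt0]] /andP[_ s_reg].
  case/andP=> xk s_le s_sum s_gt; have xE : x = k.+1.
    apply/eqP; rewrite eqn_leq xk ltnNge; apply: contra s_gt => xk'; rewrite xk' /=.
    by apply/allP => y /x_ge /= yx; apply: leq_trans yx xk'.
  rewrite xE map_f // mem_regular_le /is_regular /is_partition s_sort s_gt0 s_reg s_le /=.
  by rewrite -s_sum xE addKn.
- case/and3P => s_reg s_le s_sum; apply/and3P; split=> //.
  by apply: sub_all s_le => x; apply: leqW.
case/mapP => t; rewrite mem_regular_le.
case/and3P => /andP[/andP[t_sort t_pos] t_l] t_le /eqP t_sum ->.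
rewrite /is_regular /is_partition /= t_pos t_l lk leqnn t_le t_sum subnKC // eqxx !andbT.
by rewrite path_sortedE ?t_sort ?andbT //; apply: geq_trans.
Qed.

End RegularPartitions.

(** * Generating functions of regular partitions and bipartitions *)

Section GeneratingFunctions.

Variable R : idomainType.
Notation q := (fpsX R).
Notation euler := (euler R).

Definition regular_le_fps l k : fps R :=
  Fps (fun n => (size (regular_le l k n))%:R).

Definition regular_fps l : fps R := Fps (fun n => (size (regular_le l n n))%:R).

Lemma regular_fps_trunc l k : eqfps k (regular_fps l) (regular_le_fps l k).
Proof. by move=> n nk /=; rewrite (size_regular_le l nk). Qed.

(** For [k.+1] not divisible by [l], [size_regular_leS] says that multiplying by [1 - q^(k+1)]
    lowers the bound from [k.+1] to [k]. *)
Lemma regular_le_fps_prod l k :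
  regular_le_fps l k * \prod_(1 <= j < k.+1 | ~~ (l %| j)%N) (1 - q ^+ j) = 1.
Proof.
elim: k => [|k IHk].
  rewrite big_geq // mulr1; apply: fpsP => n.
  by rewrite coef1 -[LHS]/((size (regular_le l 0 n))%:R) size_regular_le0.
have fpsS : regular_le_fps l k.+1 = regular_le_fps l k
    + (if ~~ (l %| k.+1)%N then q ^+ k.+1 * regular_le_fps l k.+1 else 0).
  apply: fpsP => n; rewrite coefD [coef (regular_le_fps _ _) _]/= size_regular_leS natrD.
  congr (_ + _); case: (~~ _) => //; rewrite andTb coefXnM ltnS.
  by case: leqP.
rewrite big_mkcond big_nat_recr //= -big_mkcond /=.
move: fpsS; case: ifP => [lk|_] fpsS; last by rewrite mulr1 fpsS addr0.
rewrite -[RHS]IHk mulrA mulrAC; congr (_ * _).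
by rewrite mulrBr mulr1 {1}fpsS [q ^+ _ * _]mulrC addrK.
Qed.

Lemma euler_prod_dvd l k : (0 < l)%N ->
  \prod_(1 <= j < k.+1 | (l %| j)%N) (1 - q ^+ j) = dil l (euler_prod R (k %/ l)).
Proof.
case: l => // l _; elim: k => [|k IHk].
  by rewrite div0n /euler_prod !big_geq // dil1.
rewrite big_mkcond big_nat_recr //= -big_mkcond /= IHk divnS //.
case: ifP => [lk|_]; last by rewrite mulr1.
rewrite add1n [in RHS]/euler_prod prod1S dilM; congr (_ * _).
by rewrite !dilE -exprM; congr (1 - q ^+ _); rewrite -{1}(divnK lk) mulnC divnS // lk.
Qed.

Lemma regular_fps_gauss l : (0 < l)%N -> regular_fps l * euler = dil l euler.
Proof.
move=> l_gt0; apply: eqfpsP => n; have nln : (n <= l * n)%N by rewrite leq_pmull.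
(* The cut-off [l * n] is at least [n], and the multiples of [l] below it give exactly the first [n]
   factors of [f_l]. *)
apply: (@eqfps_trans _ _ (regular_le_fps l (l * n) * euler_prod R (l * n))).
  apply: (eqfpsW nln); apply: eqfpsM; first exact: regular_fps_trunc.
  exact: euler_trunc.
rewrite /euler_prod (bigID (fun j => l %| j)%N) /= mulrCA regular_le_fps_prod mulr1.
rewrite euler_prod_dvd // mulKn //.
exact/eqfps_dil/eqfps_sym/euler_trunc.
Qed.

Lemma B_convolution l m n : B l m n =
  (\sum_(i < n.+1) size (regular_le l i i) * size (regular_le m (n - i) (n - i)))%N.
Proof.
pose pairs i :=
  [seq (x, y) | x <- regular_le l i i, y <- regular_le m (n - i)%N (n - i)%N].
have pairsP i x y : ((x, y) \in pairs i) =
    (x \in regular_le l i i) && (y \in regular_le m (n - i)%N (n - i)%N).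
  apply/allpairsP/andP => [[[x' y'] [/= xi yi [-> ->]]] //|[xi yi]].
  by exists (x, y).
have in_self k d s : (s \in regular_le k d d) = is_regular k s && (sumn s == d).
  rewrite mem_regular_le; apply: andb_id2l => _; apply: andb_idl => /eqP <-.
  by apply/allP => x; apply: sumn_ge.
rewrite -(@B_size l m n [seq b | i <- iota 0 n.+1, b <- pairs i]).
- rewrite size_allpairs_dep sumnE big_map -[iota _ _]/(index_iota 0 n.+1) big_mkord.
  by apply: eq_bigr => i _; rewrite size_allpairs.
- apply: allpairs_uniq_dep; first exact: iota_uniq.
    move=> i _; apply: allpairs_uniq; rewrite ?regular_le_uniq //.
    by move=> [x y] [x' y'].
  move=> p p' pP p'P pE.
  (* The index of a pair is recovered as the sum of its first partition, so no pair is listed under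
     two indices. *)
  have key (d : {i : nat & (seq nat * seq nat)%type}) :
      d \in [seq @Tagged nat i (fun=> (seq nat * seq nat)%type) b
              | i <- iota 0 n.+1, b <- pairs i] ->
      tag d = sumn (tagged d).1.
    move=> /allpairsPdep-[i [[u v] [_ + ->]]] /=.
    by rewrite pairsP in_self => /andP[/andP[_ /eqP <-]].
  move: (key _ pP) (key _ p'P); move: pE; clear pP p'P.
  by case: p p' => [i b] [j b'] /= -> -> ->.
move=> [x y].
apply/flatten_mapP/and3P => [[i]|[xl ym /eqP xy]].
  rewrite map_id mem_iota pairsP !in_self /= ltnS.
  move=> ni /andP[/andP[-> /eqP ->] /andP[-> /eqP ->]]; split=> //.
  by rewrite subnKC.
exists (sumn x); last by rewrite map_id pairsP !in_self xl ym -xy addKn !eqxx.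
by rewrite mem_iota -xy /= add0n ltnS leq_addr.
Qed.

Lemma B_fps l m : (0 < l)%N -> (0 < m)%N ->
  Fps (fun n => (B l m n)%:R) * euler ^+ 2 = dil l euler * dil m euler.
Proof.
move=> l0 m0; rewrite -!regular_fps_gauss //.
have -> : Fps (fun n => (B l m n)%:R) = regular_fps l * regular_fps m.
  apply: fpsP => n; rewrite coefM [LHS]/= B_convolution natr_sum.
  by apply: eq_bigr => i _; rewrite natrM.
by ring.
Qed.

End GeneratingFunctions.

(** * Reduction modulo 7 and the congruences *)

Lemma B37_eta51 n : (B 3 7 n)%:R = coef (eta51 'F_7) n.
Proof.
suff <- : Fps (fun n => (B 3 7 n)%:R) = eta51 'F_7 by [].
have F7nat (x : 'F_7) : exists m, x = m%:R by exists x; rewrite natr_Zp.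
have dil7 : dil 7 (euler 'F_7) = euler 'F_7 ^+ 7.
  by apply: dil_Frobenius; rewrite ?pchar_Fp.
(* Multiplied by [f_1^2], the generating function is [f_3 f_7], which is [f_3 f_1^7] in
   characteristic 7. *)
apply: (@fps_mulI _ (euler 'F_7 ^+ 2)).
  by rewrite !coef0E expr1n oner_neq0.
by rewrite mulrC B_fps // dil7 /eta51; ring.
Qed.

Definition shift4 n := (4 * n).+1.

(** The orbit of [0] satisfies [4^j = 3 * iter j shift4 0 + 1], so the division by 3 is exact. *)
Lemma iter_shift4 k n :
  iter k shift4 n = (4 ^ k * n + (4 ^ k - 1) %/ 3)%N.
Proof.
have quarter j : (4 ^ j = (3 * iter j shift4 0).+1)%N.
  by elim: j => // j IHj; rewrite expnS IHj /= /shift4; ring.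
rewrite [in (_ - _)%N]quarter subn1 mulKn //.
elim: k => [|k IHk]; first by rewrite mul1n addn0.
by rewrite !iterS IHk expnS /shift4; ring.
Qed.

Lemma F7_seven : 7 = 0 :> 'F_7.
Proof. exact: val_inj. Qed.

Lemma B37_iter7 m n : (B 3 7 (iter (7 * m) shift4 n))%:R = 3 ^+ m * (B 3 7 n)%:R :> 'F_7.
Proof.
elim: m => [|m IHm]; first by rewrite mul1r.
by rewrite mulnS iterD B37_eta51 (eta51_iter7 _ _ F7_seven) // -B37_eta51 IHm exprS mulrA.
Qed.

Lemma F7_eqmod a b : a%:R = b%:R :> 'F_7 -> a = b %[mod 7].
Proof. by move=> /(congr1 val); rewrite /= !val_Fp_nat. Qed.

Local Close Scope ring_scope.

Theorem theorem1p1 :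
  (forall n m : nat,
     B 3 7 (4 ^ (7 * m) * n + (4 ^ (7 * m) - 1) %/ 3)
       = 3 ^ m * B 3 7 n %[mod 7]) /\
  (forall n m : nat,
     B 3 7 (4 ^ (7 * m + 7) * n + (10 * 4 ^ (7 * m + 6) - 1) %/ 3)
       = 0 %[mod 7]).
Proof.
split=> n m.
  by rewrite -iter_shift4; apply: F7_eqmod; rewrite B37_iter7 natrM natrX.
(* With [X = 4^(7m+6)], the iterate is [X (4 n + 3) + (X - 1) / 3]; since
   [10 X - 1 = 9 X + (X - 1)], the quotient by 3 splits as [3 X + (X - 1) / 3]. *)
have -> : (4 ^ (7 * m + 7) * n + (10 * 4 ^ (7 * m + 6) - 1) %/ 3 =
    iter (7 * m) shift4 (iter 6 shift4 (4 * n + 3)))%N.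
  rewrite -iterD iter_shift4.
  have -> : (4 ^ (7 * m + 7) = 4 * 4 ^ (7 * m + 6))%N by rewrite -expnS -addnS.
  have : (0 < 4 ^ (7 * m + 6))%N by rewrite expn_gt0.
  case: (4 ^ (7 * m + 6))%N => // x _.
  have -> : (10 * x.+1 - 1 = x.+1 * 3 * 3 + x)%N by rewrite mulnS addSn subn1 /=; ring.
  rewrite subn1 succnK.
  by rewrite divnMDl //; ring.
apply: F7_eqmod; rewrite B37_iter7 B37_eta51 (eta51_iter6 _ _ F7_seven) //.
by rewrite mulr0.
Qed.
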